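(* For every constant $k$, State Reachability is solvable in polynomial time on instances whose initial task network $(T,\prec^+,\alpha)$ is primitive with $\prec^+=\emptyset$ (an antichain) and whose state transition graph has at most $k$ states.
   Context: An HTN domain is a tuple $D=(F,A,\mathcal{C},\delta,M)$ where $F$ is a finite set of propositions, $A$ a set of actions, $\mathcal{C}$ a set of compound task names disjoint from $A$, $\delta$ maps each action $a$ to $(\mathrm{pre}(a),\mathrm{del}(a),\mathrm{add}(a))$, subsets of $F$, and $M$ gives decomposition methods for compound tasks. Action $a$ is executable in state $s\subseteq F$ if $\mathrm{pre}(a)\subseteq s$; executing it yields $(s\setminus\mathrm{del}(a))\cup\mathrm{add}(a)$. A task network is $(T,\prec^+,\alpha)$ with $T$ finite, $\prec^+$ a strict partial order on $T$, $\alpha:T\to A\cup\mathcal{C}$; primitive if $\alpha(T)\subseteq A$. A linearization is a total order $\bar t$ of $T$ extending $\prec^+$. For a primitive initial network $tn=(T,\prec^+,\alpha)$, a solution to $(D,tn,s_0)$ is a primitive network $(T',\prec'^+,\alpha')$ with $T'\subseteq T$, $\alpha'=\alpha|_{T'}$, $T'$ downward closed under $\prec^+$ (if $t\prec^+ t'$ and $t'\in T'$ then $t\in T'$), $\prec'^+$ containing the restriction of $\prec^+$ to $T'$, and having a linearization whose action sequence is executable from $s_0$. State Reachability: given $tn$ in $D$, initial state $s_0\subseteq F$ and target state $s_g\subseteq F$, decide whether there is a solution to $(D,tn,s_0)$ with a linearization whose execution from $s_0$ yields a state $s\supseteq s_g$. The state transition graph is the multigraph whose vertices are the states reachable from $s_0$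 by any sequence of actions of $A$, with an arc labeled $a$ from $s$ to $s'$ whenever $a$ is executable in $s$ and yields $s'$. *)

(* Defs.v *)
From mathcomp Require Import all_boot all_order.
Set Implicit Arguments. Unset Strict Implicit. Unset Printing Implicit Defensive.

(* Propositions F = 'I_nF, actions A = 'I_nA, compound task names     *)
(* C = 'I_nC (A and C are disjoint: labels live in 'I_nA + 'I_nC).    *)

Record task_network (nA nC : nat) := TaskNetwork {
  tn_size : nat;
  tn_ord  : rel 'I_tn_size;
  tn_lab  : 'I_tn_size -> ('I_nA + 'I_nC)%type
}.

Arguments tn_ord {nA nC} t _ _.
Arguments tn_lab {nA nC} t _.

Definition strict_po (T : Type) (r : rel T) : Prop :=
  (forall x, ~~ r x x) /\ (forall x y z, r x y -> r y z -> r x z).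

Definition primitive_tn nA nC (tn : task_network nA nC) : Prop :=
  forall t, if tn_lab tn t is inl _ then True else False.

Record htn_domain := HtnDomain {
  nF : nat;
  nA : nat;
  nC : nat;
  pre : 'I_nA -> {set 'I_nF};
  del : 'I_nA -> {set 'I_nF};
  add : 'I_nA -> {set 'I_nF};
  methods : seq ('I_nC * task_network nA nC)%type
}.

Definition state (D : htn_domain) := {set 'I_(nF D)}.

Definition executable (D : htn_domain) (a : 'I_(nA D)) (s : state D) : bool :=
  pre a \subset s.

Definition apply_act (D : htn_domain) (a : 'I_(nA D)) (s : state D) : state D :=
  (s :\: del a) :|: add a.

Record sr_instance := SRInstance {
  dom : htn_domain;
  tn0 : task_network (nA dom) (nC dom);
  s0  : state dom;
  sg  : state dom
}.

Fixpoint all_prop (T : Type) (P : T -> Prop) (s : seq T) : Prop :=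
  if s is x :: s' then P x /\ all_prop P s' else True.

Definition wf_instance (I : sr_instance) : Prop :=
  strict_po (tn_ord (tn0 I)) /\
  all_prop (fun m => strict_po (tn_ord m.2)) (methods (dom I)).

Fixpoint exec_tasks (I : sr_instance) (s : state (dom I))
    (l : seq 'I_(tn_size (tn0 I))) : option (state (dom I)) :=
  match l with
  | [::] => Some s
  | t :: l' =>
      match tn_lab (tn0 I) t with
      | inl a => if executable a s then exec_tasks (apply_act a s) l' else None
      | inr _ => None
      end
  end.

Definition linearization (n : nat) (T' : {set 'I_n}) (r' : rel 'I_n)
    (lin : seq 'I_n) : Prop :=
  uniq lin /\ (forall t, (t \in lin) = (t \in T')) /\
  (forall t t', t \in T' -> t' \in T' -> r' t t' -> index t lin < index t' lin).

Definition StateReach (I : sr_instance) : Prop :=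
  let tn := tn0 I in
  exists (T' : {set 'I_(tn_size tn)}) (r' : rel 'I_(tn_size tn))
         (lin : seq 'I_(tn_size tn)) (s : state (dom I)),
    (forall t, t \in T' -> if tn_lab tn t is inl _ then True else False) /\
    (forall t t', tn_ord tn t t' -> t' \in T' -> t \in T') /\
    (forall t t', r' t t' -> (t \in T') && (t' \in T')) /\
    strict_po r' /\
    (forall t t', t \in T' -> t' \in T' -> tn_ord tn t t' -> r' t t') /\
    linearization T' r' lin /\
    exec_tasks (s0 I) lin = Some s /\ sg I \subset s.

Definition trans_rel (D : htn_domain) : rel (state D) :=
  fun s s' => [exists a : 'I_(nA D), executable a s && (s' == apply_act a s)].

Definition reachable_states (D : htn_domain) (s : state D) : {set state D} :=
  [set s' | connect (@trans_rel D) s s'].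

Definition in_class (k : nat) (I : sr_instance) : Prop :=
  primitive_tn (tn0 I) /\
  (forall t t', ~~ tn_ord (tn0 I) t t') /\
  #|reachable_states (s0 I)| <= k.

Definition unary (n : nat) : seq bool := nseq n true ++ [:: false].

Definition bits_set (n : nat) (S : {set 'I_n}) : seq bool :=
  [seq i \in S | i <- enum 'I_n].

Definition onehot (n : nat) (i : 'I_n) : seq bool :=
  [seq j == i | j <- enum 'I_n].

Definition enc_label nA nC (x : ('I_nA + 'I_nC)%type) : seq bool :=
  match x with
  | inl a => onehot a ++ nseq nC false
  | inr c => nseq nA false ++ onehot c
  end.

Definition enc_tn nA nC (tn : task_network nA nC) : seq bool :=
  unary (tn_size tn) ++
  flatten [seq [seq tn_ord tn i j | j <- enum 'I_(tn_size tn)]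
          | i <- enum 'I_(tn_size tn)] ++
  flatten [seq enc_label (tn_lab tn i) | i <- enum 'I_(tn_size tn)].

Definition enc_domain (D : htn_domain) : seq bool :=
  unary (nF D) ++ unary (nA D) ++ unary (nC D) ++
  flatten [seq bits_set (pre a) ++ bits_set (del a) ++ bits_set (add a)
          | a <- enum 'I_(nA D)] ++
  unary (size (methods D)) ++
  flatten [seq onehot m.1 ++ enc_tn m.2 | m <- methods D].

Definition enc_instance (I : sr_instance) : seq bool :=
  enc_domain (dom I) ++ enc_tn (tn0 I) ++ bits_set (s0 I) ++ bits_set (sg I).

Inductive move := MoveL | MoveR | MoveN.

Record TM := MkTM {
  tm_Q : finType;
  tm_G : finType;
  tm_blank : tm_G;
  tm_in : bool -> tm_G;
  tm_start : tm_Q;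
  tm_delta : tm_Q -> tm_G -> option (tm_Q * tm_G * move); (* None = halt *)
  tm_acc : pred tm_Q
}.

(* configuration: state, tape left of the head (nearest cell first),
   tape from the head rightwards (empty = blanks) *)
Definition config (M : TM) := (tm_Q M * seq (tm_G M) * seq (tm_G M))%type.

Definition tm_init (M : TM) (w : seq bool) : config M :=
  (tm_start M, [::], map (tm_in M) w).

Definition tm_step (M : TM) (c : config M) : option (config M) :=
  let: (q, l, r) := c in
  match tm_delta q (head (tm_blank M) r) with
  | None => None
  | Some (q', x, mv) =>
      let r' := behead r in
      match mv with
      | MoveL => match l with
                 | [::] => Some (q', [::], tm_blank M :: x :: r')
                 | y :: l' => Some (q', l', y :: x :: r')
                 end
      | MoveR => Some (q', x :: l, r')
      | MoveN => Some (q', l, x :: r')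
      end
  end.

Fixpoint tm_run (M : TM) (n : nat) (c : config M) : option bool :=
  match tm_step c with
  | None => Some (@tm_acc M c.1.1)
  | Some c' => if n is n'.+1 then tm_run n' c' else None
  end.

Definition poly_time_solvable (Inst : Type) (enc : Inst -> seq bool)
    (Prom Ans : Inst -> Prop) : Prop :=
  exists (M : TM) (c d : nat), forall I, Prom I ->
    exists b : bool,
      tm_run (c * (size (enc I)) ^ d + c) (tm_init M (enc I)) = Some b /\
      (b <-> Ans I).

(* Main.v *)
Require Import Defs.
From mathcomp Require Import all_boot all_order zify.
Set Implicit Arguments. Unset Strict Implicit. Unset Printing Implicit Defensive.

(** In a walk through the state transition graph all loops can be cut, and this only
frees tasks; since the network is an antichain, a plan thus exists iff there is one
with fewer than [k] tasks, and a brute-force search over [k]-tuples of tasks decides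
the problem. Whether a tuple is a plan is checked one proposition at a time, so the
search needs only a fixed number of pointers into the read-only input. Such pointer
programs run on a Turing machine whose tape cells carry sets of pointers. Their running
time needs no accounting: a halting deterministic run never repeats a configuration,
and there are only polynomially many. *)

(** A state has [nF] bits, more than a bounded number of pointers can hold. The check can still be
    done with bounded memory because preconditions and the goal are conjunctions and an action
    changes each proposition independently of the others: a sequence of tasks is a plan iff every
    single proposition passes the preconditions and the goal along its own history, and one such
    history needs only its current value and a verdict. Cutting loops leaves pairwise distinct
    states, whence the bound by the number of states; dropping tasks is harmless since every subset
    of an antichain is downward closed and may be ordered at will. The number of pointers, [19 + k],
    is fixed, so sets of pointers form a finite tape alphabet, and each pointer instruction costs
    one sweep over the tape and back. Counting configurations bounds only runs known to halt;
    halting is supplied by the total correctness proof, whose [exec] derivations are finite. *)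

Section Steps.
Variables (C : Type) (f : C -> option C).

Definition steps n (c c' : C) : Prop := iter n (obind f) (Some c) = Some c'.

Lemma steps_trans m n c1 c2 c3 : steps m c1 c2 -> steps n c2 c3 -> steps (m + n) c1 c3.
Proof. by rewrite /steps addnC iterD => ->. Qed.

Lemma steps1 c c' : f c = Some c' -> steps 1 c c'.
Proof. by []. Qed.

Lemma stepsS n c1 c2 c3 : f c1 = Some c2 -> steps n c2 c3 -> steps n.+1 c1 c3.
Proof. by move=> /steps1; apply: steps_trans. Qed.

Lemma stepsSr n c1 c2 c3 : steps n c1 c2 -> f c2 = Some c3 -> steps n.+1 c1 c3.
Proof. by move=> h /steps1; rewrite -[n.+1]addn1; apply: steps_trans. Qed.

Lemma iter_obind_None n : iter n (obind f) None = None.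
Proof. by elim: n => //= n ->. Qed.

Lemma steps_take m n c c' : m <= n -> steps n c c' -> exists c'', steps m c c''.
Proof.
move=> /subnK <-; rewrite /steps iterD.
by case: (iter m _ _) => [c''|]; [exists c''|rewrite iter_obind_None].
Qed.

(* A repeated configuration would make the run loop forever. *)
Lemma halting_run_lt_card (K : finType) (key : C -> K) n c c' :
  steps n c c' -> f c' = None ->
  (forall i j a b, steps i c a -> steps j c b -> key a = key b -> a = b) ->
  n < #|K|.
Proof.
move=> hn hc' hkey.
pose g (i : 'I_n.+1) := oapp key (key c) (iter i (obind f) (Some c)).
have lt_inj (i j : 'I_n.+1) : i < j -> g i <> g j.
  move=> lt_ij.
  have [a ha] : exists a, steps i c a by apply: steps_take hn; rewrite -ltnS.
  have [b hb] : exists b, steps j c b by apply: steps_take hn; rewrite -ltnS.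
  rewrite /g ha hb /= => eab; have {}eab := hkey _ _ _ _ ha hb eab.
  have le_jn : j <= n by rewrite -ltnS.
  (* As [a = b], the tail of the run after time [j] can be replayed from time [i]. It reaches the
     halting [c'] at time [i + (n - j) < n], so no configuration is left at time [n]. *)
  have hbn : steps (n - j) b c'.
    by move: hn; rewrite /steps -{1}(subnK le_jn) iterD hb.
  have := steps_trans ha; rewrite eab => /(_ _ _ hbn) h1.
  have [d hd] : exists d, n = (i + (n - j)).+1 + d.
    exists (j - i.+1); move: lt_ij le_jn; lia.
  by move: hn; rewrite /steps hd addnC iterD iterS h1 /= hc' iter_obind_None.
have g_inj : injective g.
  move=> i j e; apply/val_inj; case: (ltngtP i j) => // lt; first by case: (lt_inj _ _ lt).
  by case: (lt_inj _ _ lt).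
by have := leq_card g g_inj; rewrite card_ord.
Qed.

End Steps.

(** * Pointer programs and their simulation by a Turing machine *)

Section PointerLanguage.
Variable H : finType.

Definition store := {ffun H -> nat}.

Inductive test := TBit of H | TEq of H & H.

Inductive cmd :=
| Adv of H
| Cpy of H & H
| Seq of cmd & cmd
| When of bool & test & cmd
| While of bool & test & cmd.

Definition upd (p : store) x v : store := [ffun y => if y == x then v else p y].

Definition store0 : store := [ffun=> 0].

Section Semantics.
Variable w : seq bool.
Local Notation N := (size w).

Definition evalt t (p : store) : bool :=
  match t with TBit x => nth false w (p x) | TEq x y => p x == p y end.

(* Pointers are capped at [size w], which reads as [false]. *)
Inductive exec : cmd -> store -> store -> Prop :=
| ExecAdv x p : exec (Adv x) p (upd p x (minn (p x).+1 N))
| ExecCpy x y p : exec (Cpy x y) p (upd p x (p y))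
| ExecSeq c1 c2 p1 p2 p3 :
    exec c1 p1 p2 -> exec c2 p2 p3 -> exec (Seq c1 c2) p1 p3
| ExecWhen1 b t c p p' :
    evalt t p = b -> exec c p p' -> exec (When b t c) p p'
| ExecWhen0 b t c p : evalt t p <> b -> exec (When b t c) p p
| ExecWhile1 b t c p1 p2 p3 :
    evalt t p1 = b -> exec c p1 p2 -> exec (While b t c) p2 p3 ->
    exec (While b t c) p1 p3
| ExecWhile0 b t c p : evalt t p <> b -> exec (While b t c) p p.

End Semantics.

Inductive instr (Q : Type) :=
| IAdv of H & Q
| ICpy of H & H & Q
| IJmp of bool & test & Q & Q
| IHalt of bool.
Arguments IHalt {Q} _.

Definition istep (w : seq bool) (Q : Type) (code : Q -> instr Q) (c : Q * store) :
    option (Q * store) :=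
  let: (q, p) := c in
  match code q with
  | IAdv x q' => Some (q', upd p x (minn (p x).+1 (size w)))
  | ICpy x y q' => Some (q', upd p x (p y))
  | IJmp b t q1 q2 => Some (if evalt w t p == b then q1 else q2, p)
  | IHalt _ => None
  end.

Fixpoint pts (c : cmd) : finType :=
  match c with
  | Adv _ | Cpy _ _ => unit
  | Seq c1 c2 => (pts c1 + pts c2)%type
  | When _ _ c | While _ _ c => option (pts c)
  end.

Fixpoint entry (c : cmd) : pts c :=
  match c with
  | Adv _ | Cpy _ _ => tt
  | Seq c1 c2 => inl (entry c1)
  | When _ _ _ | While _ _ _ => None
  end.

(** [inj] embeds the points of a fragment into the full control set and [out] is the point that
    follows it, so fragments nest without any renumbering of addresses. The body of a [While]
    receives the loop head as its exit. *)
Fixpoint compile (c : cmd) (Q : Type) : (pts c -> Q) -> Q -> pts c -> instr Q :=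
  match c with
  | Adv x => fun _ out _ => IAdv x out
  | Cpy x y => fun _ out _ => ICpy x y out
  | Seq c1 c2 => fun inj out u =>
      match u with
      | inl u1 => compile (inj \o inl) (inj (inr (entry c2))) u1
      | inr u2 => compile (inj \o inr) out u2
      end
  | When b t c => fun inj out u =>
      match u with
      | None => IJmp b t (inj (Some (entry c))) out
      | Some u => compile (inj \o Some) out u
      end
  | While b t c => fun inj out u =>
      match u with
      | None => IJmp b t (inj (Some (entry c))) out
      | Some u => compile (inj \o Some) (inj None) u
      end
  end.

(** Induction on the derivation, not on [c]: the last premise of a loop round concerns the same
    [While], hence the same [inj] and [out]. *)
Lemma compile_exec w (Q : Type) (code : Q -> instr Q) c p p' :
  exec w c p p' -> forall inj out, (forall u, code (inj u) = compile inj out u) ->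
  exists n, steps (istep w code) n (inj (entry c), p) (out, p').
Proof.
elim: c p p' / => [x p|x y p|c1 c2 p1 p2 p3 _ IH1 _ IH2|b t c p p' e _ IH|b t c p e|
    b t c p1 p2 p3 e _ IH1 _ IH2|b t c p e] inj out /= h.
- by exists 1; apply: steps1; rewrite /= h.
- by exists 1; apply: steps1; rewrite /= h.
- have [n1 h1] := IH1 (inj \o inl) (inj (inr (entry c2))) (fun u => h (inl u)).
  have [n2 h2] := IH2 (inj \o inr) out (fun u => h (inr u)).
  by exists (n1 + n2); apply: steps_trans h1 h2.
- have [n hn] := IH (inj \o Some) out (fun u => h (Some u)).
  by exists n.+1; apply: stepsS hn; rewrite /= h e eqxx.
- by exists 1; apply: steps1; rewrite /= h; move/eqP/negPf: e => ->.
- have [n1 h1] := IH1 (inj \o Some) (inj None) (fun u => h (Some u)).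
  have [n2 h2] := IH2 inj out h.
  exists (n1 + n2).+1; apply: stepsS (steps_trans h1 h2).
  by rewrite /= h e eqxx.
- by exists 1; apply: steps1; rewrite /= h; move/eqP/negPf: e => ->.
Qed.

Definition bounded (N : nat) (p : store) : Prop := forall x, p x <= N.

Lemma istep_bounded w (Q : Type) (code : Q -> instr Q) q p q' p' :
  istep w code (q, p) = Some (q', p') -> bounded (size w) p -> bounded (size w) p'.
Proof.
rewrite /istep; case: (code q) => [x r|x y r|b t r1 r2|//] [_ <-] // bp z;
  by rewrite ffunE; case: eqP => // _; rewrite geq_minr.
Qed.

Lemma steps_bounded w (Q : Type) (code : Q -> instr Q) n c c' :
  steps (istep w code) n c c' -> bounded (size w) c.2 -> bounded (size w) c'.2.
Proof.
move=> + bc; elim: n c' => [|n IH] c'; first by case=> <-.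
rewrite /steps iterS; case E: (iter n _ _) => [[q p]|//] /=.
by case: c' => q' p' hs; apply: istep_bounded hs (IH _ E).
Qed.

Lemma steps_lt_card w (Q : finType) (code : Q -> instr Q) n c c' :
  bounded (size w) c.2 -> steps (istep w code) n c c' -> istep w code c' = None ->
  n < #|Q| * (size w).+1 ^ #|H|.
Proof.
move=> bc hn hc'.
(* [inord] is faithful only on values up to [size w]; this is why [halting_run_lt_card] asks the key
   to separate only configurations met along the run, where boundedness is known. *)
pose key (d : Q * store) : Q * {ffun H -> 'I_(size w).+1} :=
  (d.1, [ffun x => inord (d.2 x)]).
have -> : #|Q| * (size w).+1 ^ #|H| = #|{: Q * {ffun H -> 'I_(size w).+1}}|.
  by rewrite card_prod card_ffun card_ord.
apply: (halting_run_lt_card (key := key) hn hc') => i j [q p] [r s] hp hs.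
have {hp}/= bp := steps_bounded hp bc; have {hs}/= bs := steps_bounded hs bc.
case=> -> e.
congr (_, _); apply/ffunP => x.
by move/ffunP/(_ x): e; rewrite !ffunE => /(congr1 val); rewrite /= !inordK ?ltnS.
Qed.

(** * One pointer instruction as one sweep of a single-tape machine *)

Section Simulation.
Variables (Q : finType) (code : Q -> instr Q) (q0 : Q).

(* The letter [None] marks the cell just after the input. *)
Definition cell := (option bool * {set H})%type.

Definition put (b : bool) x (hs : {set H}) : {set H} := if b then x |: hs else hs :\ x.

(** [acc] is the only information carried along a sweep. For [IAdv] it says that [x] was marked on
    the preceding cell and must be put down here; the case [s == None] leaves the mark on the end
    cell, which realises the cap. For a jump it says that a cell already passed made the test
    true. *)
Definition scan_cell (i : instr Q) (acc : bool) (c : cell) : bool * cell :=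
  let: (s, hs) := c in
  match i with
  | IAdv x _ => (x \in hs, (s, put (acc || ((x \in hs) && (s == None))) x hs))
  | ICpy x y _ => (acc, (s, put (y \in hs) x hs))
  | IJmp _ (TBit x) _ _ => (acc || ((x \in hs) && (s == Some true)), c)
  | IJmp _ (TEq x y) _ _ => (acc || ((x \in hs) && (y \in hs)), c)
  | IHalt _ => (acc, c)
  end.

Definition next (i : instr Q) (acc : bool) : option Q :=
  match i with
  | IAdv _ q | ICpy _ _ q => Some q
  | IJmp b _ q1 q2 => Some (if acc == b then q1 else q2)
  | IHalt _ => None
  end.

(* Control states: [inl false] and [inl true] initialise the tape, [inr (q, None)]
   walks back to the left end before instruction [q], and [inr (q, Some acc)]
   executes instruction [q] in one sweep to the right. *)
Definition sim_state := (bool + Q * option bool)%type.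

Definition sim_delta (s : sim_state) (g : option cell) :
    option (sim_state * option cell * move) :=
  match s, g with
  | inl false, Some (a, _) => Some (inl true, Some (a, setT), MoveR)
  | inl false, None => None
  | inl true, Some _ => Some (s, g, MoveR)
  | inl true, None => Some (inr (q0, None), Some (None, set0), MoveL)
  | inr (q, None), Some _ => Some (s, g, MoveL)
  | inr (q, None), None => Some (inr (q, Some false), None, MoveR)
  | inr (q, Some acc), Some c =>
      let: (acc', c') := scan_cell (code q) acc c in
      if next (code q) acc' is Some q' then
        if c.1 is None then Some (inr (q', None), Some c', MoveL)
        else Some (inr (q, Some acc'), Some c', MoveR)
      else None
  | inr (q, Some _), None => None
  end.

Definition sim_acc (s : sim_state) : bool :=
  if s is inr (q, _) then if code q is IHalt b then b else false else false.

Definition sim_TM : TM :=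
  @MkTM sim_state (option cell) None (fun b => Some (Some b, set0)) (inl false)
    sim_delta sim_acc.

Local Notation tstep := (@tm_step sim_TM).

(** Turning round at the left end writes an explicit blank there. The first return therefore finds
    nothing to the left of the input and all later ones find one blank, which the machine cannot
    tell apart. *)
Lemma sim_return q (u : seq cell) y r l :
  l = [::] \/ l = [:: None] ->
  steps tstep (size u + 2) (inr (q, None), map Some u ++ l, Some y :: r)
    (inr (q, Some false), [:: None], rev (map Some u) ++ Some y :: r).
Proof.
move=> hl; elim: u y r => [|z u IH] y r /=.
  by case: hl => ->; apply: (stepsS (f := tstep)); last apply: steps1.
rewrite rev_cons cat_rcons; apply: stepsS (IH _ _); by [].
Qed.

Variable w : seq bool.
Local Notation N := (size w).
Hypothesis w_gt0 : 0 < N.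

Definition cell_at (p : store) i : cell :=
  (if i < N then Some (nth false w i) else None, [set x | p x == i]).

Definition tape (p : store) : seq (option cell) := [seq Some (cell_at p i) | i <- iota 0 N.+1].

Definition sim_config q p : config sim_TM := (inr (q, Some false), [:: None], tape p).

(** Carried bits and cells are arbitrary functions here, so the induction on the stretch does not
    see what the instruction does. The condition on [(old j).1] keeps the stretch off the end cell,
    where the machine turns. *)
Lemma sim_sweep q (acc : nat -> bool) (old new : nat -> cell) i d l r :
  (forall j, i <= j < i + d -> scan_cell (code q) (acc j) (old j) = (acc j.+1, new j)) ->
  (forall j, i <= j < i + d -> (old j).1 != None) ->
  (forall b, next (code q) b != None) ->
  steps tstep d (inr (q, Some (acc i)), l, [seq Some (old j) | j <- iota i d] ++ r)
    (inr (q, Some (acc (i + d))), rev [seq Some (new j) | j <- iota i d] ++ l, r).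
Proof.
move=> + + hn; elim: d i l => [|d IH] i l h1 h2 /=; first by rewrite addn0.
rewrite rev_cons cat_rcons addnS -addSn; apply: stepsS (IH i.+1 _ _ _).
- rewrite /tm_step /= h1 ?leqnn ?addnS ?ltnS ?leq_addr //.
  case: (next _ _) (hn (acc i.+1)) => // q' _.
  by case: (old i).1 (h2 i) => //; rewrite leqnn addnS ltnS leq_addr => /(_ isT).
- by move=> j /andP[? ?]; apply: h1; lia.
- by move=> j /andP[? ?]; apply: h2; lia.
Qed.

Lemma tapeE p :
  tape p = [seq Some (cell_at p i) | i <- iota 0 N] ++ [:: Some (cell_at p N)].
Proof. by rewrite /tape -addn1 iotaD map_cat. Qed.

(** Puts the tape to the left of the end cell in the shape that [sim_return] expects; [y] is the
    last input cell, which exists because [w] is not empty. *)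
Lemma rev_tape p (f := fun i => Some (cell_at p i)) : exists u y,
  rev [seq f i | i <- iota 0 N] = Some y :: map Some u /\
  rev (map Some u) ++ [:: Some y; Some (cell_at p N)] = tape p /\ size u = N.-1.
Proof.
have eN : iota 0 N = rcons (iota 0 N.-1) N.-1.
  by rewrite -cats1 -[in LHS](prednK w_gt0) -[_.+1]addn1 iotaD.
exists (rev [seq cell_at p i | i <- iota 0 N.-1]), (cell_at p N.-1); split; last split.
- by rewrite map_rev -map_comp eN map_rcons rev_rcons.
- by rewrite map_rev revK -map_comp tapeE eN map_rcons cat_rcons.
- by rewrite size_rev size_map size_iota.
Qed.

(** Closed form of the carried bit on arrival at cell [j], for a sweep started with [false]. *)
Definition acc_at (i : instr Q) (p : store) (j : nat) : bool :=
  match i with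
  | IAdv x _ => (p x).+1 == j
  | IJmp _ (TBit x) _ _ => (p x < j) && nth false w (p x)
  | IJmp _ (TEq x y) _ _ => (p x < j) && (p x == p y)
  | _ => false
  end.

Lemma scan_cellP q p q' p' j : j <= N -> bounded N p ->
  istep w code (q, p) = Some (q', p') ->
  scan_cell (code q) (acc_at (code q) p j) (cell_at p j) =
    (acc_at (code q) p j.+1, cell_at p' j).
Proof.
move=> jN bp; rewrite /istep; case: (code q) => [x r|x y r|b [x|x y] r1 r2|b] // [_ <-].
- rewrite /= inE eqSS; congr (_, _); congr (_, _); apply/setP => z.
  have := bp x; rewrite /put; case: ifP => h; rewrite !inE ffunE; case: eqP => [->|_] //= bx;
   move: h; case: ltnP => h; rewrite ?eqxx ?[Some _ == _]/(false) ?andbF ?andbT; lia.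
- rewrite /= inE; congr (_, _); congr (_, _); apply/setP => z.
  by rewrite /put; case: ifP => h; rewrite !inE ffunE; case: eqP => //=; rewrite h.
- rewrite /= /cell_at inE ltnS; congr (_, _).
  case: ltngtP => //= [px|->]; first by rewrite orbF.
  by case: ltnP => h; [case: (nth _ _ _)|rewrite nth_default].
- rewrite /= !inE ltnS; congr (_, _); by case: ltngtP => //= [_|->]; rewrite ?orbF // eq_sym.
Qed.

Lemma next_istep q p q' p' :
  bounded N p -> istep w code (q, p) = Some (q', p') ->
  next (code q) (acc_at (code q) p N.+1) = Some q'.
Proof.
move=> bp; rewrite /istep; case: (code q) => [x r|x y r|b [x|x y] r1 r2|b] //= [<- _] //.
  by rewrite ltnS bp.
by rewrite ltnS bp.
Qed.

Lemma next_total q p c' : istep w code (q, p) = Some c' ->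
  forall b, next (code q) b != None.
Proof. by rewrite /istep; case: (code q). Qed.

Lemma acc_at0 i p : acc_at i p 0 = false.
Proof. by case: i => // b []. Qed.

Lemma sim_instr q p q' p' : bounded N p -> istep w code (q, p) = Some (q', p') ->
  steps tstep (2 * N + 2) (sim_config q p) (sim_config q' p').
Proof.
move=> bp e; rewrite /sim_config tapeE -(acc_at0 (code q) p).
have hs := @sim_sweep q (acc_at (code q) p) (cell_at p) (cell_at p') 0 N [:: None]
  [:: Some (cell_at p N)] _ _ (next_total e).
(* [N] moves to the right, one on the end cell, and [N.-1 + 2] for the return to the first cell. *)
have -> : 2 * N + 2 = N + (N.-1 + 2).+1 by lia.
apply: steps_trans (hs _ _) _.
- by move=> j /andP[_ h]; apply: scan_cellP e => //; lia.
- by move=> j /andP[_ h]; rewrite /cell_at /= h.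
rewrite add0n acc_at0; have [u [y [-> [<- <-]]]] := rev_tape p'.
apply: stepsS (sim_return _ _ _ _ _); last by right.
have hd : sim_delta (inr (q, Some (acc_at (code q) p N))) (Some (cell_at p N)) =
    Some (inr (q', None), Some (cell_at p' N), MoveL).
  by rewrite /sim_delta (scan_cellP _ bp e) // (next_istep bp e) /= ltnn.
by rewrite /tm_step [tm_delta _ _]hd.
Qed.

(** All pointers start at 0, so the first cell gets [setT] and every other cell, including the end
    cell, gets [set0]; [0 < N] makes the first cell differ from the end cell. *)
Lemma sim_init : steps tstep (2 * N + 2) (tm_init sim_TM w) (sim_config q0 store0).
Proof.
have -> : 2 * N + 2 = N + (N.-1 + 2).+1 by lia.
rewrite /sim_config; have [u [y [eu [et <-]]]] := rev_tape store0.
apply: (@steps_trans _ _ _ _ _ ((inl true, Some y :: map Some u, [::]) : config sim_TM)).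
  rewrite -eu /tm_init /=.
  have init1 v l : steps tstep (size v) (inl true, l, [seq Some (Some b, set0) | b <- v])
      (inl true, rev [seq Some (Some b, set0) | b <- v] ++ l, [::]).
    elim: v l => [|b v IH] l //=; rewrite rev_cons cat_rcons.
    by apply: (stepsS (f := tstep)) (IH _).
  have -> : [seq Some (cell_at store0 i) | i <- iota 0 N] =
      Some (Some (head false w), setT) :: [seq Some (Some b, set0) | b <- behead w].
    rewrite /cell_at; case: (w) w_gt0 => //= b v _; congr (Some (_, _) :: _).
      by apply/setP => x; rewrite !inE ffunE eqxx.
    rewrite -[1]addn0 iotaDl -map_comp -[v in RHS](mkseq_nth false) /mkseq -map_comp.
    apply/eq_in_map => i; rewrite mem_iota => /= iv; rewrite add1n ltnS iv /=.
    by congr (Some (_, _)); apply/setP => x; rewrite !inE ffunE.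
  case: (w) w_gt0 => //= b v _; rewrite rev_cons -cats1.
  by apply: (stepsS (f := tstep)) (init1 v _).
apply: stepsS; first by [].
rewrite /= -et.
have -> : cell_at store0 N = (None, set0).
  rewrite /cell_at ltnn; congr (_, _); apply/setP => x; rewrite !inE ffunE.
  by case: (N) w_gt0.
have := @sim_return q0 u y [:: Some (None, set0)] [::]; rewrite cats0.
by apply; left.
Qed.

Lemma sim_run n q p : steps (istep w code) n (q0, store0) (q, p) ->
  steps tstep (n.+1 * (2 * N + 2)) (tm_init sim_TM w) (sim_config q p) /\ bounded N p.
Proof.
elim: n q p => [|n IH] q p.
  by case=> <- <-; rewrite mul1n; split; [apply: sim_init|move=> x; rewrite ffunE].
rewrite {1}/steps iterS; case E: (iter n _ _) => [[r s]|//] /= e.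
have [h bs] := IH _ _ E; split; last exact: istep_bounded e bs.
by rewrite mulSnr; apply: steps_trans h (sim_instr bs e).
Qed.

End Simulation.

Lemma tm_run_steps M m n (c c' : config M) : steps (@tm_step M) m c c' ->
  tm_step c' = None -> m <= n -> tm_run n c = Some (@tm_acc M c'.1.1).
Proof.
elim: m n c => [|m IH] n c.
  by case=> -> hc _; case: n => /=; rewrite hc.
rewrite /steps iterSr /=; case E: (tm_step c) => [c1|]; last by rewrite iter_obind_None.
by move=> h hc; case: n => // n hn /=; rewrite E (IH n).
Qed.

Theorem exec_poly_time_solvable (Inst : Type) (enc : Inst -> seq bool)
    (Prom Ans : Inst -> Prop) (c : cmd) (b : bool) (t : test) :
  (forall I, Prom I -> 0 < size (enc I) /\
     exists2 p, exec (enc I) c store0 p & (evalt (enc I) t p = b <-> Ans I)) ->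
  poly_time_solvable enc Prom Ans.
Proof.
move=> hc; pose Q : finType := (option (pts c) + bool)%type.
pose out : Q := inl None.
pose code (q : Q) : instr Q :=
  match q with
  | inl (Some u) => compile (fun u => inl (Some u)) out u
  | inl None => IJmp b t (inr true) (inr false)
  | inr a => IHalt a
  end.
pose q0 : Q := inl (Some (entry c)).
pose K := #|Q|; pose h := #|H|.
(* There are fewer than [K * (size w).+1 ^ h] instructions, and each of them, as well as the
   initialisation, takes [2 * size w + 2] moves: hence the degree [h.+1]. The factor [2 ^ h.+1] pays
   for replacing [(size w).+1] by [2 * size w]. *)
exists (sim_TM code q0), (2 * K.+1 * 2 ^ h.+1), h.+1 => I /hc[w_gt0 [p ep ans]].
set w := enc I in w_gt0 ep ans *.
have [n1 h1] := compile_exec ep (code := code) (inj := fun u => inl (Some u))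
  (out := out) (fun u => erefl).
pose a := evalt w t p == b.
have {h1} h2 : steps (istep w code) n1.+1 (q0, store0) (inr a, p).
  by apply: stepsSr h1 _; rewrite /= -/a; case: (a).
have b0 : bounded (size w) store0 by move=> x; rewrite ffunE.
have lt_n := steps_lt_card (c := (q0, store0)) b0 h2 erefl.
have [h3 _] := sim_run w_gt0 h2.
exists a; split; last by rewrite -ans; split=> /eqP.
have := tm_run_steps h3; apply => //.
rewrite -/K -/h in lt_n.
have le2 : (size w).+1 ^ h.+1 <= 2 ^ h.+1 * size w ^ h.+1.
  by rewrite -expnMn leq_exp2r //; lia.
have : n1.+2 * (2 * size w + 2) <= 2 * K.+1 * (size w).+1 ^ h.+1.
  rewrite expnS; have : 0 < (size w).+1 ^ h by rewrite expn_gt0.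
  nia.
move/leq_trans; apply; rewrite -mulnA; apply: leq_trans (leq_addr _ _).
by rewrite -!mulnA !leq_mul2l le2 !orbT.
Qed.

End PointerLanguage.

(** * Total correctness of pointer programs *)

Declare Scope cmd_scope.
Notation "c1 ;; c2" := (Seq c1 c2) (at level 60, right associativity) : cmd_scope.
Local Open Scope cmd_scope.

Section ProgramLogic.
Variables (H : finType) (w : seq bool).
Local Notation N := (size w).
Local Notation store := (store H).
Local Notation cmd := (cmd H).
Implicit Types (c : cmd) (p : store) (x y : H).

Definition wp c (post : store -> Prop) p : Prop := exists2 p', exec w c p p' & post p'.

Fixpoint mods c y : bool :=
  match c with
  | Adv x | Cpy x _ => y == x
  | Seq c1 c2 => mods c1 y || mods c2 y
  | When _ _ c | While _ _ c => mods c y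
  end.

Lemma modsE y :
  ((forall x, mods (Adv x) y = (y == x)) * (forall x z, mods (Cpy x z) y = (y == x)) *
   (forall c1 c2, mods (c1 ;; c2) y = mods c1 y || mods c2 y) *
   (forall b t c, mods (When b t c) y = mods c y) *
   (forall b t c, mods (While b t c) y = mods c y))%type.
Proof. by []. Qed.

Definition frame c p p' : Prop := forall y, ~~ mods c y -> p' y = p y.

Lemma exec_frame c p p' : exec w c p p' -> frame c p p'.
Proof.
elim: c p p' / => [x p|x z p|c1 c2 p1 p2 p3 _ IH1 _ IH2|b t c p p' e _ IH|b t c p e|
    b t c p1 p2 p3 e _ IH1 _ IH2|b t c p e] y //=.
- by rewrite ffunE => /negPf ->.
- by rewrite ffunE => /negPf ->.
- by rewrite negb_or => /andP[h1 h2]; rewrite IH2 // IH1.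
- exact: IH.
- by move=> h; rewrite IH2 // IH1.
Qed.

Lemma wp_conseq c (post1 post2 : store -> Prop) p :
  wp c post1 p -> (forall p', frame c p p' -> post1 p' -> post2 p') -> wp c post2 p.
Proof. by move=> [p' e h1] h; exists p' => //; apply: h h1; apply: exec_frame. Qed.

Lemma wp_seq c1 c2 (mid post : store -> Prop) p :
  wp c1 mid p -> (forall p', frame c1 p p' -> mid p' -> wp c2 post p') ->
  wp (c1 ;; c2) post p.
Proof.
move=> [p1 e1 h1] h; have [p2 e2 h2] := h _ (exec_frame e1) h1.
by exists p2 => //; apply: ExecSeq e1 e2.
Qed.

Lemma wp_adv x p : p x < N -> wp (Adv x) (fun p' => p' x = (p x).+1) p.
Proof.
move=> lt_p; exists (upd p x (minn (p x).+1 N)); first exact: ExecAdv.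
by rewrite ffunE eqxx; apply/minn_idPl.
Qed.

Lemma wp_cpy x y p : wp (Cpy x y) (fun p' => p' x = p y) p.
Proof. by exists (upd p x (p y)); [exact: ExecCpy|rewrite ffunE eqxx]. Qed.

Lemma wp_when b t c (post : store -> Prop) p :
  (evalt w t p = b -> wp c post p) -> (evalt w t p <> b -> post p) ->
  wp (When b t c) post p.
Proof.
case: (evalt w t p =P b) => e h1 h2.
  by have [p' e' h] := h1 e; exists p' => //; apply: ExecWhen1.
by exists p; [apply: ExecWhen0|apply: h2].
Qed.

(** The number [n] of rounds is known beforehand, so the index of the invariant also serves as the
    termination measure. *)
Lemma wp_while b t c n (inv : nat -> store -> Prop) (post : store -> Prop) p :
  (forall i p, i < n -> inv i p -> evalt w t p = b /\ wp c (inv i.+1) p) ->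
  (forall p, inv n p -> evalt w t p <> b /\ post p) ->
  inv 0 p -> wp (While b t c) post p.
Proof.
move=> h1 h2 h0.
have : forall d i p, i + d = n -> inv i p -> wp (While b t c) post p.
  elim=> [|d IH] i q.
    by rewrite addn0 => -> /h2[ht hq]; exists q => //; apply: ExecWhile0.
  move=> e hi; have [|ht [q1 e1 h]] := h1 i q _ hi; first by lia.
  have [|q2 e2 hq2] := IH i.+1 q1 _ h; first by lia.
  by exists q2 => //; apply: ExecWhile1 e1 e2.
by apply; last apply: h0.
Qed.

Definition unary_at a n : Prop :=
  [/\ forall i, i < n -> nth false w (a + i), nth false w (a + n) = false & a + n < N].

(** Known pointer positions are kept as a list so that their preservation becomes the boolean
    [untouched], which for a concrete program is settled by computation. *)
Fixpoint holds (G : seq (H * nat)) p : Prop :=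
  if G is (x, v) :: G' then p x = v /\ holds G' p else True.

Definition untouched c (G : seq (H * nat)) : bool := all (fun xv => ~~ mods c xv.1) G.

Lemma holds_frame c G p p' : frame c p p' -> holds G p -> untouched c G -> holds G p'.
Proof.
move=> fr; elim: G => //= [[x v] G IH] [e1 e2] /andP[hx hG].
by split; [rewrite fr|apply: IH].
Qed.

Lemma untouched_sub c G (vs : seq H) : (forall y, mods c y -> y \in vs) ->
  all (fun xv => xv.1 \notin vs) G -> untouched c G.
Proof. by move=> h; apply: sub_all => xv; apply/contraNN/h. Qed.

(** Common specification of the code that skips a block. The displacement does not depend on where
    [x] stands, so displacements add up under [Seq] and are multiplied by the number of rounds under
    a loop; [G] fixes the pointers that the loops consult. *)
Definition shift (G : seq (H * nat)) c x s : Prop :=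
  forall p, holds G p -> p x + s <= N -> wp c (fun p' => p' x = p x + s) p.

Lemma shift_adv G x : shift G (Adv x) x 1.
Proof. by move=> p _; rewrite !addn1 => h; apply: wp_adv. Qed.

Lemma shift_seq G c1 c2 x s1 s2 : untouched c1 G ->
  shift G c1 x s1 -> shift G c2 x s2 -> shift G (c1 ;; c2) x (s1 + s2).
Proof.
move=> u1 h1 h2 p hp hN; apply: wp_seq (h1 _ hp _) _; first by lia.
move=> p1 /holds_frame/(_ hp u1) g1 e1; apply: wp_conseq (h2 _ g1 _) _; first by lia.
by move=> p2 _ ->; lia.
Qed.

(* [x] runs over the ones of the unary block that starts at [y]. *)
Definition ForU x y c : cmd := Cpy x y ;; While true (TBit x) (c ;; Adv x).

Definition ForTo x y z c : cmd := Cpy x y ;; While false (TEq x z) (c ;; Adv x).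

Definition Scan x : cmd := While true (TBit x) (Adv x).

Lemma wp_scan x p n : unary_at (p x) n -> wp (Scan x) (fun p' => p' x = p x + n) p.
Proof.
move=> [u1 u2 u3].
apply: (@wp_while _ _ _ n (fun i p' => p' x = p x + i)) => [i q lt_i e|q e|].
- rewrite /= e u1 //; split=> //.
  by apply: wp_conseq (wp_adv _) _ => [|q' _ ->]; rewrite e; lia.
- by rewrite /= e u2.
- by rewrite addn0.
Qed.

Section CountingLoop.
Variables (x : H) (b : bool) (t : test H) (c : cmd) (a n : nat).
Variables (inv : nat -> store -> Prop) (G : seq (H * nat)).
Hypothesis le_N : a + n <= N.
Hypothesis c_x : ~~ mods c x.
Hypothesis c_G : untouched (c ;; Adv x) G.
Hypothesis inv_x : forall i p p', (forall y, y != x -> p' y = p y) -> inv i p -> inv i p'.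
Hypothesis test_true : forall i p, i < n -> p x = a + i -> holds G p -> evalt w t p = b.
Hypothesis test_false : forall p, p x = a + n -> holds G p -> evalt w t p <> b.
Hypothesis body : forall i p, i < n -> p x = a + i -> holds G p -> inv i p ->
  wp c (inv i.+1) p.

(** Common core of [ForU] and [ForTo], which differ in their test only. By [inv_x] the invariant
    ignores the counter, so it survives the [Adv x] that ends each round. *)
Lemma wp_count p : p x = a -> holds G p -> inv 0 p ->
  wp (While b t (c ;; Adv x)) (fun p' => p' x = a + n /\ inv n p') p.
Proof.
move=> px gp ip.
apply: (@wp_while _ _ _ n (fun i p' => [/\ p' x = a + i, holds G p' & inv i p'])).
- move=> i q lt_i [e g hi]; split; first exact: test_true e g.
  have [q' eq' hq] : wp (c ;; Adv x) (fun p' => p' x = a + i.+1 /\ inv i.+1 p') q.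
    apply: wp_seq (body lt_i e g hi) _ => q1 fr1 hi1.
    apply: wp_conseq (wp_adv _) _; first by rewrite fr1 // e; lia.
    move=> q2 fr2 e2; split; first by rewrite e2 fr1 // e addnS.
    by apply: inv_x hi1 => y hy; apply: fr2.
  exists q' => //; case: hq => h1 h2; split=> //.
  exact: holds_frame (exec_frame eq') g c_G.
- by move=> q [e g hi]; split; first apply: test_false.
- by rewrite addn0.
Qed.

End CountingLoop.

Lemma wp_forU x y c a n (inv : nat -> store -> Prop) G p :
  unary_at a n -> holds G p -> p y = a ->
  ~~ mods c x -> untouched (ForU x y c) G ->
  (forall i p p', (forall z, z != x -> p' z = p z) -> inv i p -> inv i p') ->
  (forall i p, i < n -> p x = a + i -> holds G p -> inv i p -> wp c (inv i.+1) p) ->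
  inv 0 p -> wp (ForU x y c) (fun p' => p' x = a + n /\ inv n p') p.
Proof.
move=> [u1 u2 u3] g py c_x uG inv_x body ip.
have uG2 : untouched (c ;; Adv x) G.
  by apply: sub_all uG => xv; rewrite /= !negb_or => /andP[_ ->].
have uG1 : untouched (Cpy x y) G.
  by apply: sub_all uG => xv; rewrite /= !negb_or => /andP[->].
apply: wp_seq (wp_cpy _ _ _) _ => p1 fr e; rewrite py in e.
apply: (@wp_count x _ _ _ a n inv G) => //; try exact: ltnW.
- by move=> i q lt_i e1 _; rewrite /= e1; apply: u1.
- by move=> q e1 _; rewrite /= e1 u2.
- exact: holds_frame fr g uG1.
- by apply: inv_x ip => z hz; apply: fr.
Qed.

Lemma wp_forTo x y z c a n (inv : nat -> store -> Prop) G p :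
  a + n <= N -> holds G p -> p y = a -> p z = a + n -> z != x ->
  ~~ mods c x -> ~~ mods c z -> untouched (ForTo x y z c) G ->
  (forall i p p', (forall y, y != x -> p' y = p y) -> inv i p -> inv i p') ->
  (forall i p, i < n -> p x = a + i -> holds G p -> inv i p -> wp c (inv i.+1) p) ->
  inv 0 p -> wp (ForTo x y z c) (fun p' => p' x = a + n /\ inv n p') p.
Proof.
move=> le_N g py pz zx c_x c_z uG inv_x body ip.
have uG2 : untouched (c ;; Adv x) G.
  by apply: sub_all uG => xv; rewrite /= !negb_or => /andP[_ ->].
have uG1 : untouched (Cpy x y) G.
  by apply: sub_all uG => xv; rewrite /= !negb_or => /andP[->].
apply: wp_seq (wp_cpy _ _ _) _ => p1 fr e; rewrite py in e.
(* The limit [z] joins the context because the test consults it in every round. *)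
apply: (@wp_count x _ _ _ a n inv ((z, a + n) :: G)) => //.
- by rewrite /= negb_or c_z zx.
- by move=> i q lt_i e1 [/= -> _]; rewrite e1; apply/eqP; lia.
- by move=> q e1 [/= -> _]; rewrite e1 eqxx.
- by move=> i q lt_i e1 [/= _ g1]; apply: body.
- by split; [rewrite fr|exact: holds_frame fr g uG1].
- by apply: inv_x ip => v hv; apply: fr.
Qed.

Lemma shift_forU G x y c z a n s :
  unary_at a n -> (forall p, holds G p -> p y = a) ->
  [&& ~~ mods c x, x != z & untouched (ForU x y c) G] ->
  shift G c z s -> shift G (ForU x y c) z (n * s).
Proof.
move=> un hy /and3P[c_x xz uG] hc p g le_N.
have [|||p' e []] := @wp_forU x y c a n (fun i p' => p' z = p z + i * s) G p un g (hy _ g)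
  c_x uG; last by exists p'.
- by move=> i q q' e <-; apply: e; rewrite eq_sym.
- move=> i q lt_i qx gq qz; apply: wp_conseq (hc _ gq _) _; first by rewrite qz; nia.
  by move=> q' _ ->; rewrite qz; lia.
- by rewrite addn0.
Qed.

Lemma wp_shift_forTo G x y u c z a n s p :
  a + n <= N -> holds G p -> p y = a -> p u = a + n ->
  [&& ~~ mods c x, ~~ mods c u, x != z, u != x & untouched (ForTo x y u c) G] ->
  shift G c z s -> p z + n * s <= N ->
  wp (ForTo x y u c) (fun p' => p' z = p z + n * s) p.
Proof.
move=> aN g py pu /and5P[c_x c_u xz ux uG] hc le_N.
have [|||p' e []] := @wp_forTo x y u c a n (fun i p' => p' z = p z + i * s) G p aN g py pu ux
  c_x c_u uG; last by exists p'.
- by move=> i q q' e <-; apply: e; rewrite eq_sym.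
- move=> i q lt_i qx gq qz; apply: wp_conseq (hc _ gq _) _; first by rewrite qz; nia.
  by move=> q' _ ->; rewrite qz; lia.
- by rewrite addn0.
Qed.

(** [cmd] has no empty program, so [c0] closes the sequence; the search program uses the idle copy
    [Cpy hi hi]. *)
Fixpoint seqs (T : Type) (f : T -> cmd) (c0 : cmd) (l : seq T) : cmd :=
  if l is u :: l' then f u ;; seqs f c0 l' else c0.

Lemma mods_seqs (T : Type) (f : T -> cmd) c0 l y :
  mods (seqs f c0 l) y = has (fun u => mods (f u) y) l || mods c0 y.
Proof. by elim: l => //= u l ->; rewrite orbA. Qed.

End ProgramLogic.

(** * The search program *)

Section Program.
Variable k : nat.

Definition ptr := ('I_19 + 'I_k)%type.
Definition hd i (lt_i : i < 19) : ptr := inl (Ordinal lt_i).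

(* [hF], [hA], [hC] point to the unary blocks of [nF], [nA], [nC]; [hD] to the actions;
   [hM] to the number of methods; [hT] to the number of tasks, [hL] to their labels;
   [hS] and [hG] to [s0] and [sg]. [hX], [hY], [hZ] read the input, [hi], [hj], [hm] count,
   [hf] is the current proposition. [hb] (the value of [hf]), [hok] and [hR] (the results
   for one tuple and for the whole search) are flags. *)
Definition hF := @hd 0 isT.
Definition hA := @hd 1 isT.
Definition hC := @hd 2 isT.
Definition hD := @hd 3 isT.
Definition hT := @hd 4 isT.
Definition hL := @hd 5 isT.
Definition hS := @hd 6 isT.
Definition hG := @hd 7 isT.
Definition hM := @hd 8 isT.
Definition hR := @hd 9 isT.
Definition hX := @hd 10 isT.
Definition hY := @hd 11 isT.
Definition hZ := @hd 12 isT.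
Definition hi := @hd 13 isT.
Definition hj := @hd 14 isT.
Definition hm := @hd 15 isT.
Definition hf := @hd 16 isT.
Definition hb := @hd 17 isT.
Definition hok := @hd 18 isT.
(* [task j] ranges over the block at [hT]; its final zero stands for no task. *)
Definition task (j : 'I_k) : ptr := inr j.

Local Notation cmd := (cmd ptr).

Definition SkipUnary x : cmd := Scan x ;; Adv x.

Definition SkipLabel x : cmd := ForU hj hA (Adv x) ;; ForU hj hC (Adv x).

(** The networks of the methods are skipped with the same code. Each use overwrites [hT] and [hL],
    which end up on the initial network because it is encoded last. *)
Definition SkipNet : cmd :=
  Cpy hT hX ;; SkipUnary hX ;; ForU hi hT (ForU hj hT (Adv hX)) ;;
  Cpy hL hX ;; ForU hi hT (SkipLabel hX).

Definition SkipAction x : cmd := ForU hj hF (Adv x ;; Adv x ;; Adv x).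

Definition Parse : cmd :=
  SkipUnary hA ;; Cpy hC hA ;; SkipUnary hC ;; Cpy hD hC ;; SkipUnary hD ;;
  Cpy hX hD ;; ForU hi hA (SkipAction hX) ;;
  Cpy hM hX ;; SkipUnary hX ;; ForU hm hM (ForU hi hC (Adv hX) ;; SkipNet) ;;
  SkipNet ;; Cpy hS hX ;; ForU hi hF (Adv hX) ;; Cpy hG hX.

(* [hb] and [hok] are true when they point to position 0, [hR] is true otherwise. *)
Definition StepBit (j : 'I_k) : cmd :=
  When true (TBit (task j)) (
    Cpy hY hL ;; ForTo hi hT (task j) (SkipLabel hY) ;;
    Cpy hZ hD ;; While false (TBit hY) (SkipAction hZ ;; Adv hY) ;;
    ForTo hi hF hf (Adv hZ) ;;
    When true (TBit hZ) (When false (TEq hb hF) (Cpy hok hA)) ;;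
    ForU hi hF (Adv hZ) ;;
    When true (TBit hZ) (Cpy hb hA) ;;
    ForU hi hF (Adv hZ) ;;
    When true (TBit hZ) (Cpy hb hF)).

Definition CheckBit : cmd :=
  Cpy hY hS ;; ForTo hi hF hf (Adv hY) ;;
  Cpy hb hA ;; When true (TBit hY) (Cpy hb hF) ;;
  seqs StepBit (Cpy hi hi) (enum 'I_k) ;;
  Cpy hY hG ;; ForTo hi hF hf (Adv hY) ;;
  When true (TBit hY) (When false (TEq hb hF) (Cpy hok hA)).

(** Any number of pointers may stand for no task, so two equal ones clash only if they read a
    one. *)
Definition CheckPair (ij : 'I_k * 'I_k) : cmd :=
  When true (TEq (task ij.1) (task ij.2)) (When true (TBit (task ij.1)) (Cpy hok hA)).

Definition pairs : seq ('I_k * 'I_k) := [seq ij <- enum {: 'I_k * 'I_k} | ij.1 != ij.2].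

Definition Check : cmd :=
  Cpy hok hF ;; seqs CheckPair (Cpy hi hi) pairs ;; ForU hf hF CheckBit ;;
  When true (TEq hok hF) (Cpy hR hA).

(** [ForU] leaves [task j] on the final zero without running its body there; the second [Nest js']
    treats that value, which means no task. The doubling of the program at each level is harmless
    since [k] is constant. *)
Fixpoint Nest (js : seq 'I_k) : cmd :=
  if js is j :: js' then ForU (task j) hT (Nest js') ;; Nest js' else Check.

Lemma nest_cons j js : Nest (j :: js) = (ForU (task j) hT (Nest js) ;; Nest js).
Proof. by []. Qed.

Definition Main : cmd := Parse ;; Nest (enum 'I_k).

Definition scratch : seq ptr := [:: hY; hZ; hi; hj; hb; hok].

Lemma mods_checkBit y : mods CheckBit y -> y \in scratch.
Proof.
apply: contraLR => y_scratch.
have ne z : z \in scratch -> (y == z) = false by move=> hz; apply: contraNF y_scratch => /eqP->.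
have := (ne hY isT, ne hZ isT, ne hi isT, ne hj isT, ne hb isT, ne hok isT) => {}ne.
rewrite /CheckBit /ForTo !modsE mods_seqs !modsE !ne !orbF.
by apply/hasPn => j _ /=; rewrite !ne.
Qed.

Lemma mods_check y : mods Check y -> y \in [:: hR, hf & scratch].
Proof.
rewrite /Check /ForU !modsE mods_seqs !modsE.
case/orP => [/eqP->//|]; case/orP => [/orP[/hasP[ij _ /eqP->//]|/eqP->//]|].
case/orP => [|/eqP->//]; case/orP => [/eqP->//|]; case/orP => [|/eqP->//].
by move/mods_checkBit => h; rewrite 2!in_cons h !orbT.
Qed.

Lemma mods_nest js y : mods (Nest js) y -> y \in [:: hR, hf & scratch] ++ map task js.
Proof.
elim: js y => [|j js IH] y; first by rewrite cats0; apply: mods_check.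
have sub z : z \in [:: hR, hf & scratch] ++ map task js ->
    z \in [:: hR, hf & scratch] ++ map task (j :: js).
  by rewrite !mem_cat /= [X in _ -> _ || X]in_cons => /orP[->|->]; rewrite ?orbT.
have jin : task j \in [:: hR, hf & scratch] ++ map task (j :: js).
  by rewrite mem_cat mem_head orbT.
rewrite nest_cons /ForU !modsE => /orP[|/IH/sub//].
by case/orP => [/eqP->//|/orP[/IH/sub//|/eqP->]].
Qed.

(** * Correctness of the search program on a word with a given layout *)

Section Correctness.
Variable w : seq bool.
Local Notation N := (size w).
Variables (nF nA nC nM nT : nat) (msize mpos : nat -> nat).
Variables (pre_bit del_bit add_bit : nat -> nat -> bool) (s0_bit sg_bit : nat -> bool).
Variable act : nat -> nat.

Definition net_size n := n.+1 + n * n + n * (nA + nC).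
Definition pA := nF.+1.
Definition pC := pA + nA.+1.
Definition pD := pC + nC.+1.
Definition pM := pD + nA * (nF * 3).
Definition pT := mpos nM.
Definition pL := pT + nT.+1 + nT * nT.
Definition pS := pL + nT * (nA + nC).
Definition pG := pS + nF.

(** Interface between program and encoding: correctness of the search uses these facts only. Bits
    are functions on [nat], so that no ordinals enter the reasoning about pointers. *)
Record layout : Prop := Layout {
  unF : unary_at w 0 nF;
  unA : unary_at w pA nA;
  unC : unary_at w pC nC;
  unM : unary_at w pM nM;
  mpos0 : mpos 0 = pM + nM.+1;
  mposS : forall i, i < nM -> mpos i.+1 = mpos i + nC + net_size (msize i);
  mpos_le : forall i, mpos i <= N;
  unm : forall i, i < nM -> unary_at w (mpos i + nC) (msize i);
  unT : unary_at w pT nT;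
  le_N : pG + nF <= N;
  nth_pre : forall a i, a < nA -> i < nF ->
    nth false w (pD + a * (nF * 3) + i) = pre_bit a i;
  nth_del : forall a i, a < nA -> i < nF ->
    nth false w (pD + a * (nF * 3) + i + nF) = del_bit a i;
  nth_add : forall a i, a < nA -> i < nF ->
    nth false w (pD + a * (nF * 3) + i + nF + nF) = add_bit a i;
  act_lt : forall t, t < nT -> act t < nA;
  nth_label : forall t i, t < nT -> i < nA ->
    nth false w (pL + t * (nA + nC) + i) = (i == act t);
  nth_s0 : forall i, i < nF -> nth false w (pS + i) = s0_bit i;
  nth_sg : forall i, i < nF -> nth false w (pG + i) = sg_bit i
}.

Hypothesis lay : layout.
Implicit Type p : store ptr.
Local Notation wp := (wp w).

Definition base1 : seq (ptr * nat) := [:: (hF, 0); (hA, pA); (hC, pC); (hD, pD); (hR, 0)].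

Lemma wp_skipUnary x p n : unary_at w (p x) n ->
  wp (SkipUnary x) (fun p' => p' x = p x + n.+1) p.
Proof.
move=> un; have [_ _ lt_N] := un; apply: wp_seq (wp_scan un) _ => p1 _ e1.
by apply: wp_conseq (wp_adv _) _ => [|p2 _ ->]; rewrite e1 ?addnS.
Qed.

Lemma shift_label G x : untouched (SkipLabel x) G -> x != hj ->
  (forall p, holds G p -> p hA = pA /\ p hC = pC) ->
  shift w G (SkipLabel x) x (nA + nC).
Proof.
move=> uG xj hG.
have u1 : untouched (ForU hj hA (Adv x)) G /\ untouched (ForU hj hC (Adv x)) G.
  by split; apply: sub_all uG => xv /=; rewrite !negb_or => /andP[].
apply: shift_seq; first by case: u1.
- rewrite -[nA]muln1; apply: shift_forU; last exact: shift_adv.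
  + exact: unA lay.
  + by move=> p /hG[].
  + by rewrite (proj1 u1) /= !(eq_sym hj) xj.
- rewrite -[nC]muln1; apply: shift_forU; last exact: shift_adv.
  + exact: unC lay.
  + by move=> p /hG[].
  + by rewrite (proj2 u1) /= !(eq_sym hj) xj.
Qed.

Lemma shift_action G x : untouched (SkipAction x) G -> x != hj ->
  (forall p, holds G p -> p hF = 0) -> shift w G (SkipAction x) x (nF * 3).
Proof.
move=> uG xj hG.
have u1 : untouched (Adv x) G.
  by apply: sub_all uG => xv /=; rewrite !negb_or => /and3P[_ /andP[]].
apply: shift_forU (unF lay) _ _ _ => //.
- by rewrite uG /= !(eq_sym hj) !(negPf xj).
- by do 2![apply: (shift_seq (s1 := 1)) => //; first exact: shift_adv]; apply: shift_adv.
Qed.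

Lemma wp_skipNet p a n : holds base1 p -> p hX = a -> unary_at w a n ->
  a + net_size n <= N ->
  wp SkipNet (fun p' => [/\ p' hT = a, p' hL = a + n.+1 + n * n &
                            p' hX = a + net_size n]) p.
Proof.
move=> g0 eX un; rewrite /net_size => leN.
apply: wp_seq (wp_cpy _ _ _ _) _ => p1 fr1 e1.
have g1 : holds ((hT, a) :: base1) p1.
  by split; [rewrite e1|exact: holds_frame fr1 g0 isT].
have x1 : p1 hX = a by rewrite fr1.
apply: wp_seq (wp_skipUnary (n := n) _) _; first by rewrite x1.
move=> p2 fr2 e2; rewrite x1 in e2.
have g2 := holds_frame fr2 g1 isT.
have sh3 : shift w ((hT, a) :: base1) (ForU hi hT (ForU hj hT (Adv hX))) hX (n * (n * 1)).
  do 2![apply: (shift_forU un) => //; first by move=> p' []]; exact: shift_adv.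
apply: wp_seq (sh3 _ g2 _) _; first by rewrite e2; nia.
move=> p3 fr3 e3; have g3 := holds_frame fr3 g2 isT.
apply: wp_seq (wp_cpy _ _ _ _) _ => p4 fr4 e4; have g4 := holds_frame fr4 g3 isT.
have x4 : p4 hX = p3 hX by rewrite fr4.
have sh5 : shift w ((hT, a) :: base1) (ForU hi hT (SkipLabel hX)) hX (n * (nA + nC)).
  apply: (shift_forU un) => //; first by move=> p' [].
  by apply: shift_label => // p' [_ [_ [-> [-> _]]]].
apply: wp_conseq (sh5 _ g4 _) _; first by rewrite x4 e3 e2; nia.
move=> p5 fr5 e5; have g5 := holds_frame fr5 g4 isT; split.
- by case: g5.
- by rewrite fr5 // e4 e3 e2 muln1.
- by rewrite e5 x4 e3 e2; lia.
Qed.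

Definition base : seq (ptr * nat) :=
  [:: (hF, 0); (hA, pA); (hC, pC); (hD, pD); (hT, pT); (hL, pL); (hS, pS); (hG, pG)].

Lemma wp_parse : wp Parse (fun p => holds base p /\ p hR = 0) (store0 ptr).
Proof.
have [u0 u1 u2] := unF lay; have leN := le_N lay.
apply: wp_seq (wp_skipUnary (n := nF) _) _; first by rewrite ffunE; apply: unF.
rewrite ffunE => p1 fr1 e1.
have F1 : p1 hF = 0 by rewrite fr1 // ffunE.
have R1 : p1 hR = 0 by rewrite fr1 // ffunE.
apply: wp_seq (wp_cpy _ _ _ _) _ => p2 fr2 e2.
apply: wp_seq (wp_skipUnary (n := nA) _) _; first by rewrite e2 e1; apply: unA.
move=> p3 fr3 e3; apply: wp_seq (wp_cpy _ _ _ _) _ => p4 fr4 e4.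
apply: wp_seq (wp_skipUnary (n := nC) _) _; first by rewrite e4 e3 e2 e1; apply: unC.
move=> p5 fr5 e5; rewrite e4 e3 e2 e1 in e5.
have g5 : holds base1 p5.
  split; first by rewrite fr5 // fr4 // fr3 // fr2.
  split; first by rewrite fr5 // fr4 // fr3 // fr2.
  split; first by rewrite fr5 // fr4 // e3 e2 e1.
  split; first by rewrite e5.
  by split => //; rewrite fr5 // fr4 // fr3 // fr2.
apply: wp_seq (wp_cpy _ _ _ _) _ => p6 fr6 e6; have g6 := holds_frame fr6 g5 isT.
have [M1 M2 M3] := unM lay.
have sh7 : shift w base1 (ForU hi hA (SkipAction hX)) hX (nA * (nF * 3)).
  apply: (shift_forU (unA lay)) => //; first by move=> p' [_ []].
  by apply: shift_action => // p' [].
apply: wp_seq (sh7 _ g6 _) _.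
  by rewrite e6 e5; move: M3; rewrite /pM /pD /pC /pA; lia.
move=> p7 fr7 e7; have g7 := holds_frame fr7 g6 isT.
have {}e7 : p7 hX = pM by rewrite e7 e6 e5.
apply: wp_seq (wp_cpy _ _ _ _) _ => p8 fr8 e8; have g8 := holds_frame fr8 g7 isT.
have x8 : p8 hX = pM by rewrite fr8.
apply: wp_seq (wp_skipUnary (n := nM) _) _; first by rewrite x8; apply: unM.
move=> p9 fr9 e9; have g9 := holds_frame fr9 g8 isT.
have m9 : p9 hM = pM by rewrite fr9 // e8.
have {}e9 : p9 hX = mpos 0 by rewrite e9 x8 (mpos0 lay).
apply: wp_seq.
  (* The networks of the methods differ in size, so this loop is not a [shift]; its invariant
     follows the individual positions [mpos i]. *)
  apply: (@wp_forU _ w hm hM _ pM nM (fun i p => p hX = mpos i) base1) => //.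
  - by move=> i q q' e <-; apply: e.
  - move=> i q lt_i qm gq qX.
    have hS := mposS lay lt_i; have hle := mpos_le lay i.+1.
    have sh : shift w base1 (ForU hi hC (Adv hX)) hX (nC * 1).
      apply: (shift_forU (unC lay)) => //; first by move=> p' [_ [_ []]].
      exact: shift_adv.
    apply: wp_seq (sh _ gq _) _; first by rewrite qX; lia.
    move=> q1 frq1 eq1; have gq1 := holds_frame frq1 gq isT.
    apply: wp_conseq (@wp_skipNet q1 _ (msize i) gq1 erefl _ _) _.
    + by rewrite eq1 qX muln1; apply: unm.
    + by rewrite eq1 qX; lia.
    + by move=> q2 _ [_ _ ->]; rewrite eq1 qX; lia.
move=> p10 fr10 [_ e10]; have g10 := holds_frame fr10 g9 isT.
apply: wp_seq (@wp_skipNet p10 pT nT g10 e10 (unT lay) _) _.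
  by move: leN; rewrite /net_size /pG /pS /pL; lia.
move=> p11 fr11 [eT eL eX]; have g11 := holds_frame fr11 g10 isT.
have {}eX : p11 hX = pS by rewrite eX /net_size /pS /pL; lia.
apply: wp_seq (wp_cpy _ _ _ _) _ => p12 fr12 e12; have g12 := holds_frame fr12 g11 isT.
have x12 : p12 hX = pS by rewrite fr12.
have sh13 : shift w base1 (ForU hi hF (Adv hX)) hX (nF * 1).
  apply: (shift_forU (unF lay)) => //; first by move=> p' [].
  exact: shift_adv.
apply: wp_seq (sh13 _ g12 _) _; first by move: leN; rewrite x12 /pG; lia.
move=> p13 fr13 e13; have g13 := holds_frame fr13 g12 isT.
apply: wp_conseq (wp_cpy _ _ _ _) _ => p14 fr14 e14.
have [? [? [? [? [? _]]]]] := holds_frame fr14 g13 isT.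
split=> //; do 4?[split=> //].
split; first by rewrite fr14 // fr13 // fr12.
split; first by rewrite fr14 // fr13 // fr12.
split; first by rewrite fr14 // fr13 // e12.
by split=> //; rewrite e14 e13 x12 muln1.
Qed.

Definition flag (b : bool) : nat := if b then 0 else pA.

Lemma flag_eq0 b : (flag b == 0) = b. Proof. by case: b. Qed.

Lemma wp_require p z b ok v : holds base p -> p hb = flag b -> p hok = flag ok ->
  nth false w (p z) = v ->
  wp (When true (TBit z) (When false (TEq hb hF) (Cpy hok hA)))
     (fun p' => p' hok = flag (ok && (v ==> b))) p.
Proof.
move=> [gF [gA _]] eb eok ez; apply: wp_when; rewrite /= ez; last first.
  by case: v {ez} => // _; rewrite andbT.
move=> ->; apply: wp_when; rewrite /= eb gF flag_eq0; last first.
  by case: b {eb} => // _; rewrite andbT.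
move=> ->; apply: wp_conseq (wp_cpy _ _ _ _) _ => p' _ ->.
by rewrite gA andbF.
Qed.

Lemma wp_setflag p z x b y v : holds base p -> p hb = flag b -> nth false w (p z) = v ->
  p x = flag y ->
  wp (When true (TBit z) (Cpy hb x)) (fun p' => p' hb = flag (if v then y else b)) p.
Proof.
move=> g eb ez ex; apply: wp_when; rewrite /= ez; last by case: v {ez}.
by move=> ->; apply: wp_conseq (wp_cpy _ _ _ _) _ => p' _ ->.
Qed.

(** [s.1] is the current value of proposition [i], and [s.2] tells whether every precondition on [i]
    has held so far. *)
Definition step_bit a i (s : bool * bool) : bool * bool :=
  (add_bit a i || s.1 && ~~ del_bit a i, s.2 && (pre_bit a i ==> s.1)).

Definition step_task i (s : bool * bool) t : bool * bool :=
  if t < nT then step_bit (act t) i s else s.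

(** The label is one-hot, so walking to its one while [hZ] skips one action per zero brings [hZ] to
    the action of the task. From there the precondition, delete and add bits of [i] are [nF] apart;
    addition is treated last and therefore prevails over deletion. *)
Lemma wp_stepBit j p i t s : holds base p -> p hf = i -> i < nF ->
  p (task j) = pT + t -> t <= nT -> p hb = flag s.1 -> p hok = flag s.2 ->
  wp (StepBit j) (fun p' => p' hb = flag (step_task i s t).1 /\
                            p' hok = flag (step_task i s t).2) p.
Proof.
move=> g0 ef lt_i et le_t eb eok; have [T1 T2 T3] := unT lay; have leN := le_N lay.
rewrite /step_task; apply: wp_when; rewrite /= et; last first.
  by case: ltnP => // lt_t; rewrite T1.
case: ltnP => [lt_t _|ge_t]; last first.
  by have -> : t = nT by [lia]; rewrite T2.
have act_t := act_lt lay lt_t.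
pose G1 := [:: (hf, i), (hb, flag s.1), (hok, flag s.2) & base].
have g : holds G1 p by [].
have lbl : t * (nA + nC) + (nA + nC) <= nT * (nA + nC) by nia.
apply: wp_seq (wp_cpy _ _ _ _) _ => p1 fr1 e1; have g1 := holds_frame fr1 g isT.
have {}e1 : p1 hY = pL by rewrite e1; case: g0 => [_ [_ [_ [_ [_ []]]]]].
apply: wp_seq.
  apply: (@wp_shift_forTo _ w G1 hi hT (task j) (SkipLabel hY) hY pT t (nA + nC)) => //.
  - by lia.
  - by case: g1 => [_ [_ [_ [_ [_ [_ [_ []]]]]]]].
  - by rewrite fr1.
  - by apply: shift_label => // q [_ [_ [_ [_ [-> [-> _]]]]]].
  - by rewrite e1; move: leN; rewrite /pG /pS; lia.
move=> p2 fr2 e2; rewrite e1 in e2; have g2 := holds_frame fr2 g1 isT.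
apply: wp_seq (wp_cpy _ _ _ _) _ => p3 fr3 e3; have g3 := holds_frame fr3 g2 isT.
have y3 : p3 hY = pL + t * (nA + nC) by rewrite fr3.
have {}e3 : p3 hZ = pD by rewrite e3; case: g2 => [_ [_ [_ [_ [_ [_ []]]]]]].
have pMN : pM <= N by have [_ _] := unM lay; lia.
have actN : act t * (nF * 3) + nF * 3 <= nA * (nF * 3) by nia.
apply: (@wp_seq _ _ _ _ (fun p => holds G1 p /\ p hZ = pD + act t * (nF * 3))).
  apply: (@wp_while _ _ _ _ _ (act t) (fun n p => [/\ holds G1 p,
    p hY = pL + t * (nA + nC) + n & p hZ = pD + n * (nF * 3)])).
  - move=> n q lt_n [gq qY qZ]; split.
      by rewrite /= qY (nth_label lay) ?ltn_eqF //; lia.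
    have sh : shift w G1 (SkipAction hZ) hZ (nF * 3).
      by apply: shift_action => // q' [_ [_ [_ []]]].
    apply: wp_seq (sh _ gq _) _; first by rewrite qZ; move: pMN; rewrite /pM; nia.
    move=> q1 fq1 eq1; have gq1 := holds_frame fq1 gq isT.
    have yq1 : q1 hY = pL + t * (nA + nC) + n by rewrite fq1.
    apply: wp_conseq (wp_adv _) _.
      by rewrite yq1; move: leN; rewrite /pG /pS; nia.
    move=> q2 fq2 eq2; have gq2 := holds_frame fq2 gq1 isT; split=> //.
      by rewrite eq2 yq1; lia.
    by rewrite fq2 // eq1 qZ; lia.
  - by move=> q [gq qY qZ]; rewrite /= qY (nth_label lay) ?eqxx.
  - by rewrite !addn0.
move=> p4 _ [g4 e4].
apply: wp_seq.
  apply: (@wp_shift_forTo _ w G1 hi hF hf (Adv hZ) hZ 0 i 1) => //.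
  - by lia.
  - by case: g4 => [_ [_ [_ []]]].
  - by case: g4.
  - exact: shift_adv.
  - by rewrite e4; move: pMN; rewrite /pM; lia.
move=> p5 fr5 e5; rewrite e4 muln1 in e5; have g5 := holds_frame fr5 g4 isT.
have [_ [b5 [ok5 _]]] := g5; have gb5 : holds base p5 by case: g5 => [_ [_ []]].
apply: wp_seq (wp_require gb5 b5 ok5 (v := pre_bit (act t) i) _) _.
  by rewrite e5 (nth_pre lay).
move=> p6 fr6 ok6.
pose G2 := [:: (hok, flag (s.2 && (pre_bit (act t) i ==> s.1))) & base].
have g6 : holds G2 p6 by split=> //; have := holds_frame fr6 gb5 isT.
have b6 : p6 hb = flag s.1 by rewrite fr6.
have z6 : p6 hZ = pD + act t * (nF * 3) + i by rewrite fr6.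
have sh : shift w G2 (ForU hi hF (Adv hZ)) hZ (nF * 1).
  apply: (shift_forU (unF lay)) => //; first by move=> p' [_ []].
  exact: shift_adv.
apply: wp_seq (sh _ g6 _) _; first by rewrite z6; move: pMN; rewrite /pM; lia.
move=> p7 fr7 e7; rewrite z6 muln1 in e7; have g7 := holds_frame fr7 g6 isT.
have b7 : p7 hb = flag s.1 by rewrite fr7.
apply: wp_seq (wp_setflag (proj2 g7) b7 (v := del_bit (act t) i) (y := false) _ _) _.
- by rewrite e7 (nth_del lay).
- by case: g7 => [_ [_ []]].
move=> p8 fr8 b8; have g8 := holds_frame fr8 g7 isT.
have z8 : p8 hZ = pD + act t * (nF * 3) + i + nF by rewrite fr8.
apply: wp_seq (sh _ g8 _) _; first by rewrite z8; move: pMN; rewrite /pM; lia.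
move=> p9 fr9 e9; rewrite z8 muln1 in e9; have g9 := holds_frame fr9 g8 isT.
have b9 : p9 hb = flag (if del_bit (act t) i then false else s.1) by rewrite fr9.
apply: wp_conseq (wp_setflag (proj2 g9) b9 (v := add_bit (act t) i) (y := true) _ _) _.
- by rewrite e9 (nth_add lay).
- by case: g9 => [_ []].
move=> p10 fr10 b10; have [ok10 _] := holds_frame fr10 g9 isT; split=> //.
rewrite b10 /step_bit /=; case: (add_bit _ _) => //=.
by case: (del_bit _ _); rewrite /= ?andbT ?andbF.
Qed.

Definition tasks (v : 'I_k -> nat) p : Prop := forall j, p (task j) = pT + v j.

Lemma tasks_frame c v p p' : frame c p p' -> tasks v p -> (forall j, ~~ mods c (task j)) ->
  tasks v p'.
Proof. by move=> fr ht hc j; rewrite fr. Qed.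

Section Valuation.
Variable v : 'I_k -> nat.
Hypothesis v_le : forall j, v j <= nT.

Definition run_bits i s : bool * bool := foldl (fun s j => step_task i s (v j)) s (enum 'I_k).

Lemma wp_stepBits l p i s : holds base p -> p hf = i -> i < nF -> tasks v p ->
  p hb = flag s.1 -> p hok = flag s.2 ->
  let s' := foldl (fun s j => step_task i s (v j)) s l in
  wp (seqs StepBit (Cpy hi hi) l)
     (fun p' => [/\ holds base p', p' hf = i, p' hb = flag s'.1 & p' hok = flag s'.2]) p.
Proof.
elim: l p s => [|j l IH] p s g ef lt_i ht eb eok.
  apply: wp_conseq (wp_cpy _ _ _ _) _ => p' fr _.
  by split; rewrite ?fr //; exact: holds_frame fr g isT.
apply: wp_seq (wp_stepBit g ef lt_i (ht j) (v_le j) eb eok) _ => p1 fr [b1 ok1].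
apply: IH b1 ok1 => //; first exact: holds_frame fr g isT.
  by rewrite fr.
exact: tasks_frame fr ht _.
Qed.

Definition bit_ok i : bool :=
  let s := run_bits i (s0_bit i, true) in s.2 && (sg_bit i ==> s.1).

(** The program keeps a single [hok] throughout all propositions, whereas [bit_ok] starts each of
    them from [true]. Verdicts are only ever conjoined, so the earlier one factors out. *)
Lemma run_bits_ok i b ok :
  run_bits i (b, ok) = ((run_bits i (b, true)).1, ok && (run_bits i (b, true)).2).
Proof.
rewrite /run_bits -{1}[ok]andbT -[b in LHS]/(b, true).1 -[X in ok && X]/(b, true).2.
elim: (enum _) (b, true) => [|j l IH] s //=.
by rewrite -IH /step_task; case: ifP => // _; rewrite /step_bit /= andbA.
Qed.

Lemma wp_checkBit p i ok : holds base p -> p hf = i -> i < nF -> tasks v p ->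
  p hok = flag ok -> wp CheckBit (fun p' => p' hok = flag (ok && bit_ok i)) p.
Proof.
move=> g ef lt_i ht eok; have leN := le_N lay.
pose G1 := [:: (hf, i), (hok, flag ok) & base].
have {g} g : holds G1 p by [].
apply: wp_seq (wp_cpy _ _ _ _) _ => p1 fr1 e1; have g1 := holds_frame fr1 g isT.
have {}e1 : p1 hY = pS by rewrite e1; case: g => [_ [_ [_ [_ [_ [_ [_ [_ []]]]]]]]].
have ht1 := tasks_frame fr1 ht (fun=> isT).
apply: wp_seq.
  apply: (@wp_shift_forTo _ w G1 hi hF hf (Adv hY) hY 0 i 1) => //.
  - by lia.
  - by case: g1 => [_ [_ []]].
  - by case: g1.
  - exact: shift_adv.
  - by rewrite e1; move: leN; rewrite /pG; lia.
move=> p2 fr2 e2; rewrite e1 muln1 in e2; have g2 := holds_frame fr2 g1 isT.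
have ht2 := tasks_frame fr2 ht1 (fun=> isT).
apply: wp_seq (wp_cpy _ _ _ _) _ => p3 fr3 e3; have g3 := holds_frame fr3 g2 isT.
have ht3 := tasks_frame fr3 ht2 (fun=> isT).
have b3 : p3 hb = flag false by rewrite e3; case: g2 => [_ [_ [_ []]]].
have gb3 : holds base p3 by case: g3 => [_ []].
apply: wp_seq (wp_setflag gb3 b3 (v := s0_bit i) (y := true) _ _) _.
- by rewrite fr3 // e2 (nth_s0 lay).
- by case: gb3.
move=> p4 fr4 b4; have [f4 [ok4 _]] := holds_frame fr4 g3 isT.
have g4 := holds_frame fr4 gb3 isT; have ht4 := tasks_frame fr4 ht3 (fun=> isT).
have {}b4 : p4 hb = flag (s0_bit i, ok).1 by rewrite b4; case: (s0_bit i).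
apply: wp_seq (wp_stepBits (enum 'I_k) g4 f4 lt_i ht4 b4 ok4) _.
rewrite -/(run_bits _ _) run_bits_ok /= => p5 _ [g5 f5 b5 ok5].
set s := run_bits i _ in b5 ok5.
pose G2 := [:: (hf, i), (hb, flag s.1), (hok, flag (ok && s.2)) & base].
have {}g5 : holds G2 p5 by [].
apply: wp_seq (wp_cpy _ _ _ _) _ => p6 fr6 e6; have g6 := holds_frame fr6 g5 isT.
have {}e6 : p6 hY = pG.
  by rewrite e6; case: g5 => [_ [_ [_ [_ [_ [_ [_ [_ [_ [_ []]]]]]]]]]].
apply: wp_seq.
  apply: (@wp_shift_forTo _ w G2 hi hF hf (Adv hY) hY 0 i 1) => //.
  - by lia.
  - by case: g6 => [_ [_ [_ []]]].
  - by case: g6.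
  - exact: shift_adv.
  - by rewrite e6; lia.
move=> p7 fr7 e7; rewrite e6 muln1 in e7.
have [_ [b7 [ok7 g7]]] := holds_frame fr7 g6 isT.
apply: wp_conseq (wp_require (v := sg_bit i) g7 b7 ok7 _) _.
  by rewrite e7 (nth_sg lay).
by move=> p8 _ ->; rewrite -andbA.
Qed.

Definition pair_ok (ij : 'I_k * 'I_k) : bool := (v ij.1 == v ij.2) ==> (nT <= v ij.1).

Lemma wp_checkPairs l p ok : holds base p -> tasks v p -> p hok = flag ok ->
  wp (seqs CheckPair (Cpy hi hi) l)
     (fun p' => [/\ holds base p', tasks v p' & p' hok = flag (ok && all pair_ok l)]) p.
Proof.
have [T1 T2 T3] := unT lay.
elim: l p ok => [|ij l IH] p ok g ht eok.
  apply: wp_conseq (wp_cpy _ _ _ _) _ => p' fr _; rewrite andbT.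
  split; [exact: holds_frame fr g isT|exact: tasks_frame fr ht _|by rewrite fr].
apply: (@wp_seq _ _ _ _ (fun p' => p' hok = flag (ok && pair_ok ij))).
  apply: wp_when; rewrite /= !ht eqn_add2l /pair_ok; last first.
    by case: eqP => // _ _; rewrite andbT.
  move=> ->; apply: wp_when; rewrite /= ht.
    move=> ev; apply: wp_conseq (wp_cpy _ _ _ _) _ => p' _ ->.
    have -> : nT <= v ij.1 = false.
      by apply/negP => h; have := v_le ij.1; move=> h'; move: ev; have -> : v ij.1 = nT by [lia];
         rewrite T2.
    by rewrite andbF; case: g => [_ []].
  case: (leqP nT (v ij.1)) => [|lt_v]; first by rewrite andbT.
  by rewrite T1.
move=> p1 fr1 ok1 /=; rewrite andbA; apply: IH ok1.
  exact: holds_frame fr1 g isT.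
exact: tasks_frame fr1 ht _.
Qed.

Definition valid : bool := all pair_ok pairs && all bit_ok (iota 0 nF).

Lemma wp_check p r : holds base p -> tasks v p -> p hR = flag (~~ r) ->
  wp Check (fun p' => p' hR = flag (~~ (r || valid))) p.
Proof.
move=> g ht eR; apply: wp_seq (wp_cpy _ _ _ _) _ => p1 fr1 e1.
have g1 := holds_frame fr1 g isT; have ht1 := tasks_frame fr1 ht (fun=> isT).
have {}e1 : p1 hok = flag true by rewrite e1; case: g.
apply: wp_seq (wp_checkPairs pairs g1 ht1 e1) _ => p2 fr2 [g2 ht2 e2].
have modsP y : mods (seqs CheckPair (Cpy hi hi) pairs) y -> y \in [:: hok; hi].
  by rewrite mods_seqs => /orP[/hasP[ij _ /eqP->]|/eqP->].
have R2 : p2 hR = flag (~~ r).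
  by rewrite fr2 ?fr1 //; apply/(contraNN (modsP _)).
have modsB y : mods (ForU hf hF CheckBit) y -> y \in [:: hf & scratch].
  rewrite /ForU !modsE => /or3P[/eqP->|/mods_checkBit h|/eqP->] //.
  by rewrite in_cons h orbT.
apply: wp_seq.
  apply: (@wp_forU _ w hf hF CheckBit 0 nF (fun i p => tasks v p /\
    p hok = flag (all pair_ok pairs && all bit_ok (iota 0 i))) base) => //.
  - exact: unF lay.
  - by case: g2.
  - by apply/(contraNN (@mods_checkBit _)).
  - exact: untouched_sub modsB _.
  - move=> i q q' e [h1 h2]; split; last by rewrite e.
    by move=> j; rewrite e.
  - move=> i q lt_i qf gq [tq okq].
    apply: wp_conseq (wp_checkBit gq qf lt_i tq okq) _ => q' frq ok'; split.
      by apply: tasks_frame frq tq _ => j; apply/(contraNN (@mods_checkBit _)).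
    by rewrite ok' -addn1 iotaD all_cat /= andbT andbA.
  - by split=> //; rewrite e2 /= andbT.
move=> p3 fr3 [_ [ht3 ok3]].
have uB : untouched (ForU hf hF CheckBit) base by exact: untouched_sub modsB _.
have g3 := holds_frame fr3 g2 uB.
have R3 : p3 hR = flag (~~ r) by rewrite fr3 //; apply/(contraNN (modsB _)).
have [F3 [A3 _]] := g3.
rewrite -/valid in ok3; apply: wp_when; rewrite /= ok3 F3 flag_eq0.
  by move=> ->; apply: wp_conseq (wp_cpy _ _ _ _) _ => p4 _ ->; rewrite orbT.
by case: valid => // _; rewrite orbF.
Qed.

End Valuation.

Definition set_task (v : 'I_k -> nat) j i : 'I_k -> nat :=
  fun j' => if j' == j then i else v j'.

Fixpoint search (js : seq 'I_k) (v : 'I_k -> nat) : bool :=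
  if js is j :: js' then has (fun i => search js' (set_task v j i)) (iota 0 nT.+1)
  else valid v.

Lemma untouched_base c js :
  (forall y, mods c y -> y \in [:: hR, hf & scratch] ++ map task js) -> untouched c base.
Proof.
move=> h; apply: untouched_sub h _.
(* Membership in [map task js] does not compute for a variable [js]. This criterion does: every
   pointer of [base] is an [inl], whereas tasks are [inr]. *)
pose ok (y : ptr) := (y \notin [:: hR, hf & scratch]) && (if y is inl _ then true else false).
have ok_out y : ok y -> y \notin [:: hR, hf & scratch] ++ map task js.
  case: y => y; rewrite /ok ?andbF // andbT => hy.
  by rewrite mem_cat (negPf hy); apply/mapP => -[].
by apply: (@sub_all _ (fun xv => ok xv.1)) => // xv; apply: ok_out.
Qed.

Lemma wp_nest js v p r : uniq js -> (forall j, v j <= nT) -> holds base p ->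
  (forall j, j \notin js -> p (task j) = pT + v j) -> p hR = flag (~~ r) ->
  wp (Nest js) (fun p' => p' hR = flag (~~ (r || search js v))) p.
Proof.
elim: js v p r => [|j js IH] v p r.
  by move=> _ v_le g ht; apply: wp_check => // j; apply: ht.
rewrite cons_uniq => /andP[jNjs ujs] v_le g ht eR.
have set_le i : i <= nT -> forall j', set_task v j i j' <= nT.
  by move=> le_i j'; rewrite /set_task; case: eqP.
have modsN := @mods_nest js.
have taskN j' : j' \notin js -> ~~ mods (Nest js) (task j').
  move=> h; apply/(contraNN (modsN _)); rewrite mem_cat mem_map; last by move=> ? ? [].
  by rewrite (negPf h).
have call i (q : store ptr) : i <= nT -> q (task j) = pT + i -> holds base q ->
    (forall j', j' \notin j :: js -> q (task j') = pT + v j') -> forall r',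
    q hR = flag (~~ r') ->
    wp (Nest js) (fun p' => p' hR = flag (~~ (r' || search js (set_task v j i)))) q.
  move=> le_i qj gq hq r' qR; apply: IH => //; first exact: set_le.
  move=> j' hj'; rewrite /set_task; case: eqP => [->//|/eqP ne].
  by apply: hq; rewrite in_cons negb_or ne.
have [T1 T2 T3] := unT lay.
have uT : untouched (ForU (task j) hT (Nest js)) base.
  apply: (@untouched_base _ (j :: js)) => y hy; apply: mods_nest.
  by rewrite nest_cons modsE hy.
pose found i := has (fun i => search js (set_task v j i)) (iota 0 i).
apply: (@wp_seq _ _ _ _ (fun p' => (forall j', j' \notin j :: js -> p' (task j') = pT + v j')
    /\ p' hR = flag (~~ (r || found nT)) /\ p' (task j) = pT + nT)).
  pose inv i p := (forall j', j' \notin j :: js -> p (task j') = pT + v j') /\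
    p hR = flag (~~ (r || found i)).
  apply: wp_conseq (@wp_forU _ w (task j) hT (Nest js) pT nT inv base p (unT lay) g
    _ (taskN j jNjs) uT _ _ _) _.
  - by case: g => [_ [_ [_ [_ []]]]].
  - move=> i q q' e [h1 h2]; split; last by rewrite e.
    move=> j' hj'; rewrite e ?h1 //; apply: contraNneq hj' => -[->].
    exact: mem_head.
  - move=> i q lt_i qj gq [hq qR].
    apply: wp_conseq (call i q (ltnW lt_i) qj gq hq _ qR) _ => q' frq R'; split.
      move=> j' hj'; rewrite frq; first exact: hq.
      by apply: taskN; move: hj'; rewrite in_cons negb_or => /andP[].
    by rewrite R' /found -addn1 iotaD has_cat /= orbF orbA.
  - by split; rewrite ?orbF.
  - by move=> p' _ [e1 [e2 e3]].
move=> p1 fr1 [ht1 [R1 j1]]; have g1 := holds_frame fr1 g uT.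
(* The call after the loop adds the value [nT], which turns [found nT] into [found nT.+1], the whole
   range of [search]. *)
apply: wp_conseq (call nT p1 (leqnn _) j1 g1 ht1 _ R1) _ => p2 _ ->.
by rewrite -[search (j :: js) v]/(found nT.+1) /found -addn1 iotaD has_cat /= orbF orbA.
Qed.

Lemma exec_main : exists2 p, exec w Main (store0 ptr) p &
  (evalt w (TEq hR hF) p = false <-> search (enum 'I_k) (fun=> 0)).
Proof.
have [p e h] : wp Main (fun p => holds base p /\
    p hR = flag (~~ search (enum 'I_k) (fun=> 0))) (store0 ptr).
  apply: wp_seq wp_parse _ => p1 _ [g1 R1].
  apply: wp_conseq (@wp_nest (enum 'I_k) (fun=> 0) p1 false (enum_uniq _) _ g1 _ R1) _ => //.
    by move=> j; rewrite mem_enum.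
  move=> p2 fr R2; split=> //; apply: holds_frame fr g1 _.
  by apply: untouched_base; apply: mods_nest.
exists p => //=; case: h => -[-> _] ->; rewrite flag_eq0.
by split=> [/negbFE|->].
Qed.

End Correctness.
End Program.

(** * Short plans *)

Section Search.
Variables (k nF nT : nat) (pre_bit del_bit add_bit : nat -> nat -> bool).
Variables (s0_bit sg_bit : nat -> bool) (act : nat -> nat).
Local Notation valid := (valid nF nT pre_bit del_bit add_bit s0_bit sg_bit act).
Local Notation search := (search nF nT pre_bit del_bit add_bit s0_bit sg_bit act).
Implicit Type v : 'I_k -> nat.

Lemma eq_valid v v' : v =1 v' -> valid v = valid v'.
Proof.
move=> e; congr (_ && _); apply: eq_all => x; first by rewrite /pair_ok !e.
rewrite /bit_ok; have -> // : run_bits nT pre_bit del_bit add_bit act v x (s0_bit x, true) =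
    run_bits nT pre_bit del_bit add_bit act v' x (s0_bit x, true).
rewrite /run_bits; elim: (enum _) (_, true) => //= j l IH s.
by rewrite e IH.
Qed.

Lemma searchP (js : seq 'I_k) v : reflect
  (exists2 v', valid v' & forall j, if j \in js then v' j <= nT else v' j == v j)
  (search js v).
Proof.
apply: (iffP idP).
  elim: js v => [|j js IH] v; first by move=> h; exists v => // j; rewrite eqxx.
  move=> /hasP[i]; rewrite mem_iota /= => lt_i /IH[v' h1 h2]; exists v' => // j'.
  have := h2 j'; rewrite in_cons /set_task; case: (j' \in js); rewrite ?orbT ?orbF //.
  by case: (j' =P j) => // _ /eqP->.
move=> [v' h1]; elim: js v => [|j js IH] v h2.
  by rewrite /= (@eq_valid v v') // => j; apply/esym/eqP/h2.
apply/hasP; exists (v' j).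
  by have := h2 j; rewrite mem_head mem_iota.
apply: IH => j'; have := h2 j'; rewrite in_cons /set_task.
case: (j' \in js); rewrite ?orbT ?orbF //.
by case: (j' =P j) => // -> _; rewrite eqxx.
Qed.

End Search.

(** * Loop-free plans, and executability one proposition at a time *)

Section Reachability.
Variable I : sr_instance.
Let D := dom I.
Let tn := tn0 I.
Implicit Types (s : state D) (t : 'I_(tn_size tn)) (l : seq 'I_(tn_size tn)).
Hypothesis prim : primitive_tn tn.

Lemma exec_tasks_cons s t l s' : exec_tasks s (t :: l) = Some s' ->
  exists a, [/\ tn_lab tn t = inl a, executable a s & exec_tasks (apply_act a s) l = Some s'].
Proof.
rewrite /=; case: (tn_lab _ t) => // a; case: ifP => // h1 h2; by exists a.
Qed.

Fixpoint trace s l : seq (state D) :=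
  if l is t :: l' then
    s :: (if tn_lab tn t is inl a then trace (apply_act a s) l' else [::])
  else [:: s].

(** Provides the cut: if a loop-free run passes through [u], then its remaining part leads from [u]
    to the same final state. *)
Lemma exec_trace_suffix s l s' u : exec_tasks s l = Some s' -> uniq (trace s l) ->
  u \in trace s l -> exists l', [/\ subseq l' l, exec_tasks u l' = Some s' & uniq (trace u l')].
Proof.
elim: l s => [|t l IH] s.
  by case=> <- _ /[!inE] /eqP->; exists [::].
move=> e; have [a [ea ex e']] := exec_tasks_cons e.
have uE : trace s (t :: l) = s :: trace (apply_act a s) l by rewrite /= ea.
rewrite uE in_cons => un; case: (u =P s) => [-> _|_ /= hu].
  by exists (t :: l); rewrite subseq_refl uE.
have [||l' [h1 h2 h3]] := IH _ e'; [by case/andP: un|by []|].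
by exists l'; split=> //; apply: subseq_trans h1 (subseq_cons _ _).
Qed.

(* Cutting the loops of a walk only frees tasks. *)
Lemma exec_loop_free s l s' : exec_tasks s l = Some s' ->
  exists l', [/\ subseq l' l, exec_tasks s l' = Some s' & uniq (trace s l')].
Proof.
elim: l s => [|t l IH] s; first by case=> <-; exists [::].
move=> e; have [a [ea ex e']] := exec_tasks_cons e.
have [l1 [h1 h2 h3]] := IH _ e'.
have [hs|hs] := boolP (s \in trace (apply_act a s) l1).
  have [l2 [h4 h5 h6]] := exec_trace_suffix h2 h3 hs.
  exists l2; split=> //.
  exact: subseq_trans h4 (subseq_trans h1 (subseq_cons _ _)).
exists (t :: l1); rewrite /= ea ex eqxx; split=> //=.
by rewrite hs.
Qed.

Lemma size_trace s l s' : exec_tasks s l = Some s' -> size (trace s l) = (size l).+1.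
Proof.
elim: l s => //= t l IH s; case: (tn_lab _ t) => // a; case: ifP => // _ /IH.
by move=> /= ->.
Qed.

Lemma trace_reachable s l s' u : exec_tasks s l = Some s' -> u \in trace s l ->
  connect (@trans_rel D) s u.
Proof.
elim: l s => [|t l IH] s; first by move=> _ /[!inE] /eqP->.
move=> e; have [a [ea ex e']] := exec_tasks_cons e.
rewrite /= ea in_cons => /orP[/eqP->//|/(IH _ e')].
apply: connect_trans; apply: connect1; apply/existsP; exists a.
by rewrite ex eqxx.
Qed.

(** A loop-free trace consists of distinct reachable states, one more than there are tasks. Being a
    subsequence of [l], the shortened plan still uses no task twice. *)
Lemma exec_short s l s' : exec_tasks s l = Some s' -> uniq l -> exists l',
  [/\ uniq l', exec_tasks s l' = Some s' & size l' < #|reachable_states s|].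
Proof.
move=> /exec_loop_free[l' [sub e un]] ul; exists l'; split=> //.
  exact: subseq_uniq sub ul.
rewrite -(size_trace e) -(card_uniqP un); apply: subset_leq_card.
by apply/subsetP => u hu; rewrite inE; apply: trace_reachable e hu.
Qed.

Fixpoint run_bit (i : 'I_(nF D)) (b : bool) l : bool :=
  if l is t :: l' then
    if tn_lab tn t is inl a then
      ((i \in pre a) ==> b) && run_bit i ((i \in add a) || b && (i \notin del a)) l'
    else false
  else (i \in sg I) ==> b.

(** Both inclusions in a state, of preconditions and of the goal, are conjunctions over
    propositions, and effects act on each proposition separately. Primitivity matters if there are
    no propositions: the right side is then vacuous, even for a compound task. *)
Lemma run_bitP s l : (exists2 s', exec_tasks s l = Some s' & sg I \subset s') <->
  forall i, run_bit i (i \in s) l.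
Proof.
elim: l s => [|t l IH] s /=.
  split=> [[s' [<-] /subsetP h] i|h]; first by apply/implyP/h.
  by exists s => //; apply/subsetP => i; apply/implyP/h.
have := prim t; case: (tn_lab _ t) => // a _.
have eapp i : (i \in apply_act a s) = (i \in add a) || (i \in s) && (i \notin del a).
  by rewrite !inE andbC orbC.
split.
  case: ifP => [/subsetP hpre|_ []//] /IH h i.
  by rewrite -eapp h andbT; apply/implyP/hpre.
move=> h; have -> : executable a s.
  by apply/subsetP => i; apply/implyP; case/andP: (h i).
by apply/IH => i; rewrite eapp; case/andP: (h i).
Qed.

Hypothesis antichain : forall t t', ~~ tn_ord tn t t'.

Lemma StateReachP : StateReach I <->
  exists2 l, uniq l & forall i, run_bit i (i \in s0 I) l.
Proof.
split.
  move=> [T' [r' [l [s [_ [_ [_ [_ [_ [[ul _] [e sub]]]]]]]]]]].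
  by exists l => //; apply/run_bitP; exists s.
move=> [l ul /run_bitP[s e sub]].
(* In an antichain every set of tasks is downward closed and the empty order is admissible, so any
   duplicate-free sequence is a linearization. *)
exists [set t in l], (fun _ _ => false), l, s; do !split => //.
- by move=> t _; apply: prim.
- by move=> t t' h; have := antichain t t'; rewrite h.
- by move=> t t' _ _ h; have := antichain t t'; rewrite h.
- by move=> t; rewrite inE.
Qed.

Section Valid.
Variable k : nat.
Let nT := tn_size tn.
Variables (pre_bit del_bit add_bit : nat -> nat -> bool) (s0_bit sg_bit : nat -> bool).
Variable act : nat -> nat.
Hypothesis preE : forall (a : 'I_(nA D)) (i : 'I_(nF D)), pre_bit a i = (i \in pre a).
Hypothesis delE : forall (a : 'I_(nA D)) (i : 'I_(nF D)), del_bit a i = (i \in del a).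
Hypothesis addE : forall (a : 'I_(nA D)) (i : 'I_(nF D)), add_bit a i = (i \in add a).
Hypothesis s0E : forall i : 'I_(nF D), s0_bit i = (i \in s0 I).
Hypothesis sgE : forall i : 'I_(nF D), sg_bit i = (i \in sg I).
Hypothesis actE : forall t a, tn_lab tn t = inl a -> act t = a.
Local Notation valid := (@valid k (nF D) nT pre_bit del_bit add_bit s0_bit sg_bit act).
Implicit Type v : 'I_k -> nat.

(** [insub] discards the value [nT], the code for no task. *)
Definition tasks_of v : seq 'I_nT := pmap insub [seq v j | j <- enum 'I_k].

Lemma bit_okE v (i : 'I_(nF D)) :
  bit_ok nT pre_bit del_bit add_bit s0_bit sg_bit act v i =
  run_bit i (i \in s0 I) (tasks_of v).
Proof.
rewrite /bit_ok /run_bits s0E /tasks_of.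
(* The fold accumulates its verdict while [run_bit] returns it recursively, so the induction runs
   over an arbitrary verdict [ok] conjoined to the right-hand side. *)
rewrite -[RHS]andTb; move: true (i \in s0 I); elim: (enum _) => [|j l IH] ok b /=.
  by rewrite sgE.
rewrite {2 4}/step_task; case: insubP => [t lt_t et|/negPf->] /=; last exact: IH.
rewrite lt_t -et; have := prim t; case E: (tn_lab tn t) => [a|//] _.
by rewrite /step_bit (actE E) preE delE addE /= IH andbA.
Qed.

Lemma uniq_tasks_of v : all (pair_ok nT v) (pairs k) -> uniq (tasks_of v).
Proof.
move=> /allP h; rewrite /tasks_of.
have: uniq (enum 'I_k) by apply: enum_uniq.
elim: (enum 'I_k) => //= j l IH /andP[jl ul].
case: insubP => [t lt_t et|_] /=; last exact: IH.
rewrite IH // andbT mem_pmap; apply/mapP => -[x hx].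
case/mapP: hx => j' hj' -> /esym e.
have ej : v j = v j'.
  by move: e; rewrite -et; case: insubP => // t' _ <- [->].
have := h (j, j'); rewrite mem_filter mem_enum /= andbT.
have -> : j != j' by apply: contraNneq jl => ->.
by move=> /(_ isT); rewrite /pair_ok /= ej eqxx /= -ej leqNgt lt_t.
Qed.

Lemma validP : #|reachable_states (s0 I)| <= k ->
  (exists2 v, valid v & forall j, v j <= nT) <-> StateReach I.
Proof.
move=> le_k; rewrite StateReachP; split.
  move=> [v /andP[h1 /allP h2] _]; exists (tasks_of v); first exact: uniq_tasks_of.
  by move=> i; rewrite -bit_okE h2 // mem_iota /= add0n.
move=> [l ul /run_bitP[s e sub]].
have [l' [ul' e' lt_l]] := exec_short e ul.
have {}lt_l : size l' <= k by apply: leq_trans (ltnW lt_l) le_k.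
(* The default [nT] pads the short plan with absent tasks up to length [k]. *)
pose v (j : 'I_k) := nth nT [seq val t | t <- l'] j.
have v_le j : v j <= nT.
  rewrite /v; have [lt_j|le_j] := ltnP j (size l'); last by rewrite nth_default ?size_map.
  by rewrite (nth_map (tnth (in_tuple l') (Ordinal lt_j))) //; apply: ltnW; apply: ltn_ord.
have vE : tasks_of v = l'.
  rewrite /tasks_of; have -> : [seq v j | j <- enum 'I_k] =
      [seq val t | t <- l'] ++ nseq (k - size l') nT.
    apply: (@eq_from_nth _ nT); rewrite size_map size_enum_ord ?size_cat ?size_map ?size_nseq.
      by lia.
    move=> i lt_i; rewrite (nth_map (Ordinal lt_i)) ?size_enum_ord // /v nth_enum_ord //.
    rewrite nth_cat size_map; case: ltnP => // le_i; rewrite nth_nseq if_same.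
    by rewrite nth_default ?size_map.
  rewrite pmap_cat [X in _ ++ X](_ : _ = [::]) ?cats0.
    by elim: (l') => //= t l'' ->; rewrite valK.
  by elim: (k - _) => //= d ->; rewrite insubN // ltnn.
exists v => //; apply/andP; split; last first.
  apply/allP => i; rewrite mem_iota /= add0n => lt_i.
  rewrite (bit_okE v (Ordinal lt_i)) vE; move: (Ordinal lt_i).
  by apply/run_bitP; exists s.
apply/allP => -[j j']; rewrite mem_filter /= => /andP[ne _].
apply/implyP => /= /eqP ev; rewrite leqNgt; apply/negP => lt_v.
have lt_size (i : 'I_k) : v i < nT -> i < size l'.
  by rewrite /v ltnNge; apply: contraNT; rewrite -leqNgt => h; rewrite nth_default ?size_map.
have un : uniq [seq val t | t <- l'] by rewrite map_inj_uniq //; apply: val_inj.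
move: ne; rewrite -(inj_eq val_inj) -(nth_uniq nT _ _ un) ?size_map; first 1 last.
- exact: lt_size.
- by apply: lt_size; rewrite -ev.
by rewrite -/(v j) -/(v j') ev eqxx.
Qed.

End Valid.
End Reachability.

(** * The layout of an encoded instance *)

Lemma size_unary n : size (unary n) = n.+1.
Proof. by rewrite size_cat size_nseq addn1. Qed.

Lemma nth_mid (w u v z : seq bool) a i : w = u ++ v ++ z -> size u = a -> i < size v ->
  nth false w (a + i) = nth false v i.
Proof.
by move=> -> <- lt_i; rewrite nth_cat ltnNge leq_addr /= addKn nth_cat lt_i.
Qed.

Lemma unary_mid (w u z : seq bool) a n : w = u ++ unary n ++ z -> size u = a ->
  unary_at w a n.
Proof.
move=> ew ua; have lt_n i : i <= n -> i < size (unary n) by rewrite size_unary ltnS.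
split=> [i lt_i||].
- by rewrite (nth_mid ew ua) ?nth_cat ?size_nseq ?lt_i ?nth_nseq ?lt_i // lt_n // ltnW.
- by rewrite (nth_mid ew ua) ?lt_n // nth_cat size_nseq ltnn subnn.
- by rewrite ew !(size_unary, size_cat) ua; lia.
Qed.

Section UniformBlocks.
Variables (n s : nat) (f : 'I_n -> seq bool).
Hypothesis size_f : forall a, size (f a) = s.

Lemma size_blocks : size (flatten [seq f a | a <- enum 'I_n]) = n * s.
Proof.
rewrite size_flatten /shape -map_comp (eq_map (g := fun=> s)) //.
by rewrite -[n in RHS]size_enum_ord; elim: (enum _) => //= a l ->.
Qed.

Lemma nth_blocks (a : 'I_n) i : i < s ->
  nth false (flatten [seq f a | a <- enum 'I_n]) (a * s + i) = nth false (f a) i.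
Proof.
move=> lt_i.
have gen (l : seq 'I_n) b : b < size l ->
    nth false (flatten [seq f a | a <- l]) (b * s + i) = nth false (f (nth a l b)) i.
  elim: l b => // x l IH [|b] lt_b /=; first by rewrite nth_cat size_f lt_i.
  rewrite nth_cat size_f ltnNge mulSn -addnA leq_addr /= addKn; exact: IH.
by rewrite gen ?size_enum_ord // nth_ord_enum.
Qed.

End UniformBlocks.

Lemma size_bits_set n (A : {set 'I_n}) : size (bits_set A) = n.
Proof. by rewrite size_map size_enum_ord. Qed.

Lemma nth_bits_set n (A : {set 'I_n}) (i : 'I_n) : nth false (bits_set A) i = (i \in A).
Proof. by rewrite (nth_map i) ?size_enum_ord // nth_ord_enum. Qed.

Lemma size_onehot n (a : 'I_n) : size (onehot a) = n.
Proof. by rewrite size_map size_enum_ord. Qed.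

Lemma nth_onehot n (a : 'I_n) i : i < n -> nth false (onehot a) i = (i == a).
Proof.
move=> lt_i; rewrite (nth_map (Ordinal lt_i)) ?size_enum_ord //.
by rewrite -(inj_eq val_inj) /= nth_enum_ord.
Qed.

Lemma size_enc_label nA nC (x : ('I_nA + 'I_nC)%type) : size (enc_label x) = nA + nC.
Proof. by case: x => x; rewrite /= size_cat size_onehot size_nseq. Qed.

Section Layout.
Variable I : sr_instance.
Local Notation D := (dom I).
Local Notation tn := (tn0 I).
Local Notation nF := (nF D).
Local Notation nA := (nA D).
Local Notation nC := (nC D).
Local Notation nT := (tn_size tn).
Local Notation nM := (size (methods D)).
Local Notation w := (enc_instance I).

Let action a := bits_set (@pre D a) ++ bits_set (@del D a) ++ bits_set (@add D a).
Let actions := flatten [seq action a | a <- enum 'I_nA].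
Let blocks := [seq onehot m.1 ++ enc_tn m.2 | m <- methods D].
Let orders := flatten [seq [seq tn_ord tn i j | j <- enum 'I_nT] | i <- enum 'I_nT].
Let labels := flatten [seq enc_label (tn_lab tn i) | i <- enum 'I_nT].

Lemma enc_instanceE : w = unary nF ++ unary nA ++ unary nC ++ actions ++ unary nM ++
  flatten blocks ++ unary nT ++ orders ++ labels ++ bits_set (s0 I) ++ bits_set (sg I).
Proof. by rewrite /enc_instance /enc_domain /enc_tn -!catA. Qed.

Lemma size_action a : size (action a) = nF * 3.
Proof. by rewrite !size_cat !size_bits_set; lia. Qed.

Lemma size_actions : size actions = nA * (nF * 3).
Proof. exact: size_blocks size_action. Qed.

Lemma size_orders n (r : rel 'I_n) :
  size (flatten [seq [seq r i j | j <- enum 'I_n] | i <- enum 'I_n]) = n * n.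
Proof. by apply: size_blocks => i; rewrite size_map size_enum_ord. Qed.

Lemma size_labels n (f : 'I_n -> ('I_nA + 'I_nC)%type) :
  size (flatten [seq enc_label (f i) | i <- enum 'I_n]) = n * (nA + nC).
Proof. by apply: size_blocks => i; rewrite size_enc_label. Qed.

Definition enc_mpos i := pM nF nA nC + nM.+1 + size (flatten (take i blocks)).
Definition enc_msize i := nth 0 [seq tn_size m.2 | m <- methods D] i.

Lemma blocks_split i : i < nM -> exists m : 'I_nC * task_network nA nC,
  [/\ tn_size m.2 = enc_msize i,
      flatten blocks = flatten (take i blocks) ++ (onehot m.1 ++ enc_tn m.2) ++
                       flatten (drop i.+1 blocks) &
      flatten (take i.+1 blocks) = flatten (take i blocks) ++ (onehot m.1 ++ enc_tn m.2)].
Proof.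
rewrite /enc_msize /blocks; elim: (methods D) i => [|m l IH] [|i] //= lt_i.
  by exists m; rewrite drop0 take0 cats0.
have [m' [h1 h2 h3]] := IH i lt_i; exists m'; split=> //; first by rewrite h2 -!catA.
by rewrite h3 catA.
Qed.

(** These bits are read off the word itself, so the matching clauses of [layout] hold by definition;
    [enc_preE] and its companions prove that they mean membership. *)
Definition enc_pre a i := nth false w (pD nF nA nC + a * (nF * 3) + i).
Definition enc_del a i := nth false w (pD nF nA nC + a * (nF * 3) + i + nF).
Definition enc_add a i := nth false w (pD nF nA nC + a * (nF * 3) + i + nF + nF).
Definition enc_s0 i := nth false w (pS nA nC nM nT enc_mpos + i).
Definition enc_sg i := nth false w (pG nF nA nC nM nT enc_mpos + i).
Definition enc_act t : nat :=
  if insub t is Some t' then if tn_lab tn t' is inl a then val a else 0 else 0.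

Lemma enc_actE t a : tn_lab tn t = inl a -> enc_act t = a.
Proof. by move=> e; rewrite /enc_act valK e. Qed.

Lemma enc_pD : size (unary nF ++ unary nA ++ unary nC) = pD nF nA nC.
Proof. by rewrite !(size_unary, size_cat) /pD /pC /pA; lia. Qed.

Lemma enc_pT : size (unary nF ++ unary nA ++ unary nC ++ actions ++ unary nM ++
  flatten blocks) = pT nM enc_mpos.
Proof.
rewrite !(size_unary, size_cat) size_actions /pT /enc_mpos take_oversize ?size_map //.
by rewrite /pM /pD /pC /pA; lia.
Qed.

Lemma enc_pL : size (unary nF ++ unary nA ++ unary nC ++ actions ++ unary nM ++
  flatten blocks ++ unary nT ++ orders) = pL nM nT enc_mpos.
Proof.
rewrite /pL -enc_pT !(size_unary, size_cat) size_orders; lia.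
Qed.

Lemma enc_pS : size (unary nF ++ unary nA ++ unary nC ++ actions ++ unary nM ++
  flatten blocks ++ unary nT ++ orders ++ labels) = pS nA nC nM nT enc_mpos.
Proof.
by rewrite /pS -enc_pL !(size_unary, size_cat) size_labels; lia.
Qed.

Lemma enc_pG : size (unary nF ++ unary nA ++ unary nC ++ actions ++ unary nM ++
  flatten blocks ++ unary nT ++ orders ++ labels ++ bits_set (s0 I)) =
  pG nF nA nC nM nT enc_mpos.
Proof.
by rewrite /pG -enc_pS !(size_unary, size_cat) size_bits_set; lia.
Qed.

Lemma size_enc : size w = pG nF nA nC nM nT enc_mpos + nF.
Proof. by rewrite -enc_pG enc_instanceE !(size_unary, size_cat) !size_bits_set; lia. Qed.

Lemma nth_actions a i : a < nA -> i < nF * 3 ->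
  nth false w (pD nF nA nC + (a * (nF * 3) + i)) = nth false actions (a * (nF * 3) + i).
Proof.
move=> lt_a lt_i; apply: nth_mid enc_pD _; first by rewrite enc_instanceE -!catA.
by rewrite size_actions; nia.
Qed.

Lemma enc_preE (a : 'I_nA) (i : 'I_nF) : enc_pre a i = (i \in pre a).
Proof.
have lt_i : i < nF * 3 by have := ltn_ord i; lia.
rewrite /enc_pre -addnA nth_actions // (nth_blocks size_action) //.
by rewrite nth_cat size_bits_set ltn_ord nth_bits_set.
Qed.

Lemma enc_delE (a : 'I_nA) (i : 'I_nF) : enc_del a i = (i \in del a).
Proof.
have lt_i : nF + i < nF * 3 by have := ltn_ord i; lia.
have -> : enc_del a i = nth false w (pD nF nA nC + (a * (nF * 3) + (nF + i))).
  by congr nth; lia.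
rewrite nth_actions // (nth_blocks size_action) //.
rewrite nth_cat size_bits_set ltnNge leq_addr addKn /= nth_cat size_bits_set ltn_ord.
exact: nth_bits_set.
Qed.

Lemma enc_addE (a : 'I_nA) (i : 'I_nF) : enc_add a i = (i \in add a).
Proof.
have lt_i : nF + (nF + i) < nF * 3 by have := ltn_ord i; lia.
have -> : enc_add a i = nth false w (pD nF nA nC + (a * (nF * 3) + (nF + (nF + i)))).
  by congr nth; lia.
rewrite nth_actions // (nth_blocks size_action) //.
rewrite nth_cat size_bits_set ltnNge leq_addr addKn /= nth_cat size_bits_set.
by rewrite ltnNge leq_addr addKn /= nth_bits_set.
Qed.

Lemma enc_s0E (i : 'I_nF) : enc_s0 i = (i \in s0 I).
Proof.
rewrite -nth_bits_set; apply: nth_mid enc_pS _; last by rewrite size_bits_set.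
by rewrite enc_instanceE -!catA.
Qed.

Lemma enc_sgE (i : 'I_nF) : enc_sg i = (i \in sg I).
Proof.
rewrite -nth_bits_set; apply: (@nth_mid _ _ _ [::]) enc_pG _; last by rewrite size_bits_set.
by rewrite enc_instanceE cats0 -!catA.
Qed.

Lemma enc_layout : primitive_tn tn ->
  layout w nF nA nC nM nT enc_msize enc_mpos enc_pre enc_del enc_add enc_s0 enc_sg enc_act.
Proof.
move=> prim; have pMle : pM nF nA nC + nM.+1 + size (flatten blocks) <= size w.
  rewrite size_enc -enc_pG !(size_unary, size_cat) size_actions /pM /pD /pC /pA; lia.
have mposN i : enc_mpos i <= size w.
  apply: leq_trans pMle; rewrite /enc_mpos leq_add2l -{2}(cat_take_drop i blocks).
  by rewrite flatten_cat size_cat leq_addr.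
split=> //.
- by apply: (@unary_mid _ [::]); first exact: enc_instanceE.
- by apply: (@unary_mid _ (unary nF)); [exact: enc_instanceE|rewrite size_unary].
- apply: (@unary_mid _ (unary nF ++ unary nA)).
    by rewrite enc_instanceE -!catA.
  by rewrite !(size_unary, size_cat).
- apply: (@unary_mid _ (unary nF ++ unary nA ++ unary nC ++ actions)).
    by rewrite enc_instanceE -!catA.
  by rewrite /pM -enc_pD !(size_unary, size_cat) size_actions; lia.
- by rewrite /enc_mpos take0 addn0.
- move=> i lt_i; have [m [<- _ e]] := blocks_split lt_i.
  rewrite /enc_mpos e /enc_tn !(size_unary, size_cat) size_onehot size_orders size_labels /net_size.
  by lia.
- move=> i lt_i; have [m [<- e _]] := blocks_split lt_i.
  apply: (@unary_mid _ (unary nF ++ unary nA ++ unary nC ++ actions ++ unary nM ++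
    flatten (take i blocks) ++ onehot m.1)).
    by rewrite enc_instanceE e /enc_tn -!catA.
  rewrite /enc_mpos /pM -enc_pD !(size_unary, size_cat) size_onehot size_actions; lia.
- apply: unary_mid enc_pT; by rewrite enc_instanceE -!catA.
- by rewrite size_enc.
- move=> t lt_t; rewrite /enc_act insubT /=.
  by have := prim (Sub t lt_t); case: (tn_lab _ _) => // a _; apply: ltn_ord.
- move=> t i lt_t lt_i; rewrite -addnA.
  have lt_i' : i < nA + nC by lia.
  transitivity (nth false labels (t * (nA + nC) + i)).
    apply: nth_mid enc_pL _; first by rewrite enc_instanceE -!catA.
    by rewrite size_labels; nia.
  rewrite /labels (nth_blocks (s := nA + nC) _ (Ordinal lt_t)) //; last first.
    by move=> x; apply: size_enc_label.
  have := prim (Ordinal lt_t); case E: (tn_lab _ _) => [a|//] _.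
  by rewrite (enc_actE E) /= nth_cat size_onehot lt_i nth_onehot.
Qed.

End Layout.

Theorem theorem3 : forall k : nat,
  poly_time_solvable enc_instance
    (fun I => wf_instance I /\ in_class k I) StateReach.
Proof.
move=> k; apply: (exec_poly_time_solvable (c := Main k) (b := false) (t := TEq (hR k) (hF k))).
move=> I [_ [prim [anti le_k]]]; have lay := enc_layout prim.
split; first by case: (unF lay); rewrite add0n => _ _; apply: leq_ltn_trans.
have [p ep hp] := exec_main k lay; exists p => //; rewrite hp.
rewrite -(validP prim anti (@enc_preE I) (@enc_delE I) (@enc_addE I) (@enc_s0E I) (@enc_sgE I)
  (@enc_actE I) le_k).
split=> [/searchP[v v1 v2]|[v v1 v2]].
  by exists v => // j; have := v2 j; rewrite mem_enum.
by apply/searchP; exists v => // j; rewrite mem_enum; apply: v2.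
Qed.
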